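(* Let $d\ge 1$ and let $F$ be a distribution function on $\mathbb{R}$ such that $1-F(x)\sim 1/x$ as $x\to+\infty$ and $F(0-):=\lim_{x\to 0-}F(x)=0$. Let $h:\mathbb{R}_+^d\to\mathbb{R}_+$ be a continuous, $1$-positively-homogeneous function. Then the $(F,h)$-combination test is universally calibrated if and only if there exist $w_1,\dots,w_d\ge 0$ with $\sum_{i=1}^d w_i=1$ such that $$h(x)=\sum_{i=1}^d w_i x_i\qquad\text{for all }x\in\mathbb{R}_+^d.$$
   Context: $\mathbb{R}_+=[0,\infty)$. A function $h$ is $1$-positively-homogeneous if $h(ax)=a\,h(x)$ for every $a>0$ and every $x$ in its domain. For a distribution function $F$, $F^{-1}(p)=\inf\{x:F(x)\ge p\}$. Multivariate regular variation: a random vector $X$ in $\mathbb{R}^d$ is multivariate regularly varying if there exist a positive function $b(t)\to\infty$ and a non-zero Borel measure $\mu$ on $\mathbb{R}^d\setminus\{0\}$, finite on Borel sets bounded away from $0$, such that $b(t)\Pr(X\in tA)\to\mu(A)$ as $t\to\infty$ for all Borel sets $A\subset\mathbb{R}^d\setminus\{0\}$ that are bounded away from $0$ and satisfy $\mu(\partial A)=0$. Universal calibration: the $(F,h)$-combination test is universally calibrated if for every random vector $(P_i)_{i=1}^d$ with Uniform$(0,1)$ marginals such that $X=(X_i)_{i=1}^d$, $X_i:=F^{-1}(1-P_i)$, is multivariate regularly varying, one has $\lim_{t\to+\infty}\Pr(h(X)>t)/\Pr(X_1>t)=1$. *)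

(* Defs.v *)
From HB Require Import structures.
From mathcomp Require Import all_boot all_order all_algebra.
From mathcomp Require Import all_classical all_reals all_analysis.

Set Implicit Arguments.
Unset Strict Implicit.
Unset Printing Implicit Defensive.

Import Order.TTheory GRing.Theory Num.Theory.
Import numFieldNormedType.Exports.

Local Open Scope classical_set_scope.
Local Open Scope ring_scope.

Definition orthant (R : realType) (d : nat) : set 'rV[R]_d :=
  [set x | forall i, 0 <= x 0 i].

(* Functions R_+^d -> R_+ are represented by total functions on R^d; every
   condition on h, and every use of it, only concerns its values on the
   orthant. *)
Definition pos_homogeneous (R : realType) (d : nat) (h : 'rV[R]_d -> R) : Prop :=
  forall (a : R) (x : 'rV[R]_d), 0 < a -> orthant x -> h (a *: x) = a * h x.

(* For p in (0,1) the set below is nonempty and bounded below when F is a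
   distribution function. Outside (0,1), where a Uniform(0,1) variable has no
   mass, inf may take its default value 0 (empty or unbounded set). *)
Definition quantile (R : realType) (F : R -> R) (p : R) : R :=
  inf [set x | p <= F x].

Definition borel_rV (R : realType) (d : nat) :=
  g_sigma_algebraType (@open 'rV[R]_d).

Definition bounded_away0 (R : realType) (d : nat) (A : set 'rV[R]_d) : Prop :=
  exists2 e : R, 0 < e & forall x, A x -> e <= `|x|.

(* A Borel measure on R^d \ {0} is represented by its extension by zero, i.e.
   a Borel measure on R^d that gives no mass to {0}. The set A below is bounded
   away from 0, so its boundary in R^d \ {0} is its boundary in R^d. *)
Definition regularly_varying (R : realType) (d : nat) (disp : measure_display)
    (T : measurableType disp) (Pr : probability T R) (X : T -> 'rV[R]_d) : Prop :=
  measurable_fun [set: T] (X : T -> borel_rV R d) /\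
  exists (b : R -> R) (mu : {measure set (borel_rV R d) -> \bar R}),
    [/\ forall t : R, 0 < t -> 0 < b t,
        b t @[t --> +oo] --> +oo,
        mu [set 0] = 0%E /\ mu [set: 'rV[R]_d] <> 0%E,
        forall A : set (borel_rV R d), measurable A -> bounded_away0 A ->
          (mu A < +oo)%E
      & forall A : set (borel_rV R d), measurable A -> bounded_away0 A ->
          mu (closure (A : set 'rV[R]_d) `\` interior (A : set 'rV[R]_d)) = 0%E ->
          ((b t)%:E * Pr (X @^-1` [set t *: x | x in (A : set 'rV[R]_d)]))%E
            @[t --> +oo] --> mu A].

Definition uniform01 (R : realType) (disp : measure_display)
    (T : measurableType disp) (Pr : probability T R) (U : {RV Pr >-> R}) : Prop :=
  forall A : set R, measurable A -> distribution Pr U A = uniform_prob (@ltr01 R) A.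

Definition test_vector (R : realType) (d : nat) (F : R -> R) (T : Type)
    (P : 'I_d -> T -> R) (w : T) : 'rV[R]_d :=
  \row_i quantile F (1 - P i w).

Definition universally_calibrated (R : realType) (d : nat) (hd : (0 < d)%N)
    (F : R -> R) (h : 'rV[R]_d -> R) : Prop :=
  forall (disp : measure_display) (T : measurableType disp)
    (Pr : probability T R) (P : 'I_d -> {RV Pr >-> R}),
  (forall i, uniform01 (P i)) ->
  let X := test_vector F (fun i => P i : T -> R) in
  regularly_varying Pr X ->
  fine (Pr [set w | t < h (X w)]) / fine (Pr [set w | t < X w 0 (Ordinal hd)])
    @[t --> +oo] --> (1 : R).

(* Main.v *)
(* A function g that is continuous and 1-homogeneous on R^d has, under regular
   variation with limit measure mu, tails Pr(g(X) > t) equivalent to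
   mu{g > 1} / b(t), and here b(t) ~ c t with c = mu{x_i > 1} for every i, because
   the margins are known; c = 0 would force mu = 0.

   If h is a convex combination of the coordinates, it remains to see that
   g |-> mu{g > 1} is additive on nonnegative g. With r = f + g, cut the space into
   cones l r < f <= l' r; on such a cone f, g and r are proportional up to
   (l' - l) r, and mu{r > s} is a multiple of 1/s, so that the masses add up to an
   error that vanishes as the mesh does. No spectral decomposition is needed.

   Conversely, given three nonzero v_1, v_2, v_3 in the orthant with sum (1, ..., 1),
   there is a vector (P_i) with uniform margins whose X is regularly varying with
   limit measure concentrated on the three rays through the v_j, and calibration for
   it reads h(v_1) + h(v_2) + h(v_3) = 1. Splitting v + w in two ways gives
   h(v + w) = h(v) + h(w). *)
Require Import Defs.
From HB Require Import structures.
From mathcomp Require Import all_boot all_order all_algebra.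
From mathcomp Require Import all_classical all_reals all_analysis.
From mathcomp Require Import measurable_realfun.
From mathcomp Require Import ring lra.
Set Implicit Arguments.
Unset Strict Implicit.
Unset Printing Implicit Defensive.
Import Order.TTheory GRing.Theory Num.Theory.
Import numFieldNormedType.Exports.
Local Open Scope classical_set_scope.
Local Open Scope ring_scope.

(** * Continuous homogeneous functions and their tails *)

Section null_levels.
Context {R : realType} {disp : measure_display} {T : measurableType disp}.

(** Regular variation only speaks of sets with [mu]-null boundary, and the boundary of {g > s} lies
    in {g = s}, so tail limits are at first available only off countably many levels s. That is
    enough: the scaling s mu{g > s} = mu{g > 1} holds at those levels, extends to all levels by
    monotonicity, and then rules out any level of positive mass. Three rays are taken because two
    vectors with sum (1, ..., 1) would only give h(v) + h(1 - v) = 1; with three, one can stay fixed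
    while the sum of the other two is split in different ways. The sample draws j uniformly among
    the three indices and s uniformly on (0, 1], and makes each P_i a piecewise affine function of
    s. For small s with c = (v_j)_i > 0 it is s / (3 c), so that X is close to (3 / s) v_j. The
    remaining conditional mass 1 - c goes to (1/3, 1), away from the extremes; since the three
    values of c average to 1/3, each margin is exactly uniform. *)

Lemma measurable_gt_set (g : T -> R) (s : R) :
  measurable_fun setT g -> measurable [set x | s < g x].
Proof.
move=> mg; have := mg measurableT `]s, +oo[%classic (measurable_itv _).
by rewrite setTI; congr measurable; apply/seteqP; split => x /=;
  rewrite in_itv /= andbT.
Qed.

Lemma measurable_eq_set (g : T -> R) (s : R) :
  measurable_fun setT g -> measurable [set x | g x = s].
Proof. by move=> mg; have := mg measurableT [set s] (measurable_set1 s); rewrite setTI. Qed.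

(** A level of positive mass is a jump of the monotone function s |-> mu{g > s}. There are countably
    many jumps, whereas ]a, b[ has positive Lebesgue measure. *)
Lemma exists_null_level (mu : {measure set T -> \bar R}) (g : T -> R) (a b : R) :
  measurable_fun setT g -> a < b -> (mu [set x | (a < g x)%R] < +oo)%E ->
  exists2 s, a < s < b & mu [set x | g x = s] = 0%E.
Proof.
move=> mg ab fin.
have mgt s : measurable [set x | s < g x] by exact: measurable_gt_set.
have finG s : a <= s -> mu [set x | s < g x] \is a fin_num.
  move=> as_; rewrite ge0_fin_numE //; apply: le_lt_trans fin.
  by apply: le_measure; rewrite ?inE // => x /=; exact: le_lt_trans.
pose G s := - fine (mu [set x | s < g x]).
have ndG : {in `[a, b] &, nondecreasing_fun G}.
  move=> x y; rewrite !in_itv /= => /andP[ax _] /andP[ay _] xy.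
  rewrite lerN2 fine_le ?finG // le_measure ?inE // => z /=.
  exact: le_lt_trans.
have cD := discontinuity_countable ndG.
have [s [sab nD]] : exists s, s \in (`]a, b[) /\ ~ discontinuity G s.
  apply: contrapT => H.
  have E : `]a, b[%classic = [set x | x \in (`]a, b[) /\ discontinuity G x].
    apply/seteqP; split => [x /= xab|x [] //].
    by split => //; apply: contrapT => nD; apply: H; exists x.
  move: (countable_lebesgue_measure0 cD); rewrite -E lebesgue_measure_itv /= lte_fin ab.
  by rewrite -EFinD => -[] /eqP; rewrite subr_eq0 gt_eqF.
have /andP[as_ sb] : a < s < b by move: sab; rewrite in_itv.
exists s; first by rewrite as_ sb.
have cl : cvg (G x @[x --> s^'-]).
  apply: nondecreasing_at_left_is_cvgr; near=> r.
    apply: sub_in2 ndG => z; rewrite !in_itv /= => /andP[rz zs].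
    rewrite (le_trans _ (ltW rz)) ?(le_trans (ltW zs)) ?(ltW sb) //.
    by near: r; exact: nbhs_left_ge.
  exists (G s) => _ /= [z + <-]; rewrite in_itv /= => /andP[rz zs].
  have ar : a <= r by near: r; exact: nbhs_left_ge.
  by apply: ndG; rewrite ?in_itv /= ?(ltW sb) ?(ltW as_) ?(ltW zs) ?(le_trans ar) ?(ltW rz)
    ?(le_trans (ltW zs)) ?(ltW sb).
have cr : cvg (G x @[x --> s^'+]).
  apply: nondecreasing_at_right_is_cvgr; near=> r.
    apply: sub_in2 ndG => z; rewrite !in_itv /= => /andP[sz zr].
    rewrite (le_trans (ltW as_) (ltW sz)) (le_trans (ltW zr)) //.
    by near: r; exact: nbhs_right_le.
  exists (G s) => _ /= [z + <-]; rewrite in_itv /= => /andP[sz zr].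
  have rb : r <= b by near: r; exact: nbhs_right_le.
  by apply: ndG; rewrite ?in_itv /= ?(ltW sb) ?(ltW as_) ?(ltW sz) ?(le_trans (ltW as_)) 
    ?(ltW sz) ?(le_trans (ltW zr)).
have elr : lim (G x @[x --> s^'-]) = lim (G x @[x --> s^'+]).
  by apply/eqP; apply: contrapT => /negP H; apply: nD.
(* {g = s} and {g > s2} are disjoint parts of {g > s1}. Letting s1 and s2 tend to s, where the
   one-sided limits of [G] agree, leaves no mass for {g = s}. *)
have jump s1 s2 : a <= s1 < s -> s < s2 <= b ->
    G s1 + fine (mu [set x | g x = s]) <= G s2.
  move=> /andP[as1 s1s] /andP[ss2 s2b].
  have fe : mu [set x | g x = s] \is a fin_num.
    rewrite ge0_fin_numE //; apply: le_lt_trans fin.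
    apply: le_measure; rewrite ?inE //; first exact: measurable_eq_set.
    by move=> x /= ->.
  have as2 : a <= s2 by exact: (le_trans (ltW as_) (ltW ss2)).
  rewrite /G addrC lerBlDr [leRHS]addrC lerBrDr -!fineD ?finG //.
  apply: fine_le; rewrite ?fin_numD ?fe ?finG //=.
  rewrite -measureU //; [|exact: measurable_eq_set|].
    apply: le_measure; rewrite ?inE //.
      by apply: measurableU => //; exact: measurable_eq_set.
    by move=> x [/= ->|/=] //; exact: lt_trans (lt_trans s1s ss2).
  by apply/seteqP; split => // x [/= ->]; rewrite ltNge (ltW ss2).
have : fine (mu [set x | g x = s]) <= 0.
  rewrite -(subrr (lim (G x @[x --> s^'-]))) {1}elr lerBrDr addrC.
  rewrite -lerBrDr; apply: limr_le => //; near=> s1.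
  rewrite lerBrDr; apply: limr_ge => //; near=> s2.
  apply: jump.
    by apply/andP; split; near: s1; [exact: nbhs_left_ge|exact: nbhs_left_lt].
  by apply/andP; split; near: s2; [exact: nbhs_right_gt|exact: nbhs_right_le].
move=> le0.
have fe : mu [set x | g x = s] \is a fin_num.
  rewrite ge0_fin_numE //; apply: le_lt_trans fin.
  apply: le_measure; rewrite ?inE //; first exact: measurable_eq_set.
  by move=> x /= ->.
apply/eqP; rewrite eq_le measure_ge0 andbT -(fineK fe) lee_fin //.
Unshelve. all: by end_near. Qed.

End null_levels.

(** Defined on the whole space because [mu] is not assumed to live on the orthant, and without a
    sign condition so that the differences f - l r that cut out cones are allowed. *)
Definition cone_fun {R : realType} {d : nat} (g : 'rV[R]_d -> R) : Prop :=
  continuous g /\ forall (a : R) x, 0 < a -> g (a *: x) = a * g x.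

Section cone_functions.
Context {R : realType} {d : nat}.
Implicit Types g f : 'rV[R]_d -> R.

Lemma open_measurable_rV (A : set (borel_rV R d)) :
  open (A : set 'rV[R]_d) -> measurable A.
Proof. by move=> oA; apply: sub_sigma_algebra. Qed.

Lemma measurable_boundary (A : set 'rV[R]_d) :
  measurable (closure A `\` interior A : set (borel_rV R d)).
Proof.
rewrite setDE; apply: measurableI; last first.
  by apply: measurableC; apply: open_measurable_rV; exact: open_interior.
rewrite -[X in measurable X]setCK; apply: measurableC; apply: open_measurable_rV.
by rewrite openC; exact: closed_closure.
Qed.

Lemma continuous_open_gt g (s : R) : continuous g -> open [set x | s < g x].
Proof.
move=> cg; have := open_comp (f := g) (D := [set y | s < y]).
by apply; [move=> x _; exact: cg|exact: open_gt].
Qed.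

Lemma continuous_measurable_rV g :
  continuous g -> measurable_fun setT (g : borel_rV R d -> R).
Proof.
move=> cg; apply: (measurability _ (RGenOInfty.measurableE R)).
move=> _ [_ [x ->] <-]; rewrite setTI; apply: open_measurable_rV.
rewrite [X in open X](_ : _ = [set y | x < g y]); first exact: continuous_open_gt.
by apply/seteqP; split => y /=; rewrite in_itv /= andbT.
Qed.

Lemma cone_fun0 g : cone_fun g -> g 0 = 0.
Proof.
move=> [_ hg]; have := hg 2 0 (ltr0Sn R 1); rewrite scaler0 mulr_natl mulr2n.
by move/eqP; rewrite eq_sym -subr_eq0 addrK => /eqP.
Qed.

(** Homogeneity forces g 0 = 0, and continuity keeps g below s near 0. *)
Lemma cone_fun_away g (s : R) : cone_fun g -> 0 < s ->
  bounded_away0 [set x | s < g x].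
Proof.
move=> cg s0; have g0 := cone_fun0 cg; case: cg => cg _.
have /nbhs_ballP [e /= e0 H] : nbhs (0 : 'rV[R]_d) [set x | g x < s].
  apply: open_nbhs_nbhs; split; last by rewrite /= g0.
  apply: (open_comp (f := g) (D := [set y | y < s])); last exact: open_lt.
  by move=> x _; exact: cg.
exists e => // x /= sg; rewrite leNgt; apply/negP => xe.
have : g x < s by apply: H; rewrite -ball_normE /= sub0r normrN.
by rewrite ltNge (ltW sg).
Qed.

Lemma cone_fun_scale_set g (s t : R) : cone_fun g -> 0 < t ->
  [set t *: x | x in [set x | s < g x]] = [set x | t * s < g x].
Proof.
move=> [_ hg] t0; apply/seteqP; split => [_ [x /= sg <-]|x /= sg].
  by rewrite /= hg // ltr_pM2l.
exists (t^-1 *: x); last by rewrite scalerA divff ?gt_eqF // scale1r.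
by rewrite /= hg ?invr_gt0 // mulrC ltr_pdivlMr // mulrC.
Qed.

Lemma continuous_boundary g (s : R) : continuous g ->
  closure [set x | s < g x] `\` interior [set x | s < g x] `<=` [set x | g x = s].
Proof.
move=> cg x /= [clx nix].
have : ~ (s < g x).
  by move=> sg; apply: nix; move: (continuous_open_gt (s := s) cg); rewrite openE; exact.
move/negP; rewrite -leNgt => gs; apply/eqP; rewrite eq_le gs /=.
have cl : closed [set y | s <= g y].
  apply: (closed_comp (f := g) (D := [set y | s <= y])); last exact: closed_ge.
  by move=> y _; exact: cg.
have : closure [set y | s < g y] `<=` [set y | s <= g y].
  by rewrite closureE => y; apply; split => // z /= /ltW.
by apply.
Qed.

Lemma cone_funD f g : cone_fun f -> cone_fun g -> cone_fun (fun x => f x + g x).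
Proof.
move=> [cf hf] [cg hg]; split; last by move=> a x a0; rewrite hf // hg // mulrDr.
by move=> x; exact: (cvgD (cf x) (cg x)).
Qed.

Lemma cone_funZ (k : R) f : cone_fun f -> cone_fun (fun x => k * f x).
Proof.
move=> [cf hf]; split; last by move=> a x a0; rewrite hf // mulrCA.
by move=> x; exact: (cvgM (cvg_cst k) (cf x)).
Qed.

Lemma cone_fun_min f g : cone_fun f -> cone_fun g -> cone_fun (fun x => Num.min (f x) (g x)).
Proof.
move=> [cf hf] [cg hg]; split.
  by move=> x; apply: continuous_min; [exact: cf|exact: cg].
by move=> a x a0; rewrite hf // hg // minr_pMr // ltW.
Qed.

Lemma cone_fun_cst0 : cone_fun (fun _ : 'rV[R]_d => 0 : R).
Proof. by split; [exact: cst_continuous|move=> a x _; rewrite mulr0]. Qed.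

(** The positive part stands in for the coordinate: it agrees with it on samples, which lie in the
    orthant, and it is nonnegative everywhere, as additivity of masses requires. *)
Lemma cone_fun_coord_pos (i : 'I_d) : cone_fun (fun x : 'rV[R]_d => Num.max (x 0 i) 0).
Proof.
split; last by move=> a x a0; rewrite mxE maxr_pMr ?mulr0 // ltW.
move=> x; apply: (@continuous_max _ _ (fun y : 'rV[R]_d => y 0 i) (fun=> 0) x).
  exact: coord_continuous.
exact: cst_continuous.
Qed.

End cone_functions.

(** * Tails and limit masses under regular variation *)

Section regular_variation.
Context {R : realType} {d : nat} {disp : measure_display} {T : measurableType disp}.
Variables (Pr : probability T R) (X : T -> 'rV[R]_d) (b : R -> R).
Variable mu : {measure set (borel_rV R d) -> \bar R}.
Hypothesis mX : measurable_fun [set: T] (X : T -> borel_rV R d).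
Hypothesis mu_fin : forall A : set (borel_rV R d), measurable A -> bounded_away0 A ->
  (mu A < +oo)%E.
Hypothesis mu_lim : forall A : set (borel_rV R d), measurable A -> bounded_away0 A ->
  mu (closure (A : set 'rV[R]_d) `\` interior (A : set 'rV[R]_d)) = 0%E ->
  ((b t)%:E * Pr (X @^-1` [set t *: x | x in (A : set 'rV[R]_d)]))%E
    @[t --> +oo] --> mu A.

Definition tail (g : 'rV[R]_d -> R) (t : R) : R := fine (Pr [set w | t < g (X w)]).
Definition mass (g : 'rV[R]_d -> R) (s : R) : R := fine (mu [set x | s < g x]).

Lemma measurable_gt_comp g (t : R) : continuous g -> measurable [set w | t < g (X w)].
Proof.
move=> cg; apply: (@measurable_gt_set _ _ _ (g \o X)).
by apply: measurableT_comp mX; exact: continuous_measurable_rV.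
Qed.

Lemma mass_fin g s : cone_fun g -> 0 < s -> mu [set x | s < g x] \is a fin_num.
Proof.
move=> cg s0; rewrite ge0_fin_numE //; apply: mu_fin; last exact: cone_fun_away.
by apply: open_measurable_rV; apply: continuous_open_gt; case: cg.
Qed.

Lemma tail_lim g (s : R) : cone_fun g -> 0 < s -> mu [set x | g x = s] = 0%E ->
  b t * tail g (t * s) @[t --> +oo] --> mass g s.
Proof.
move=> cg s0 null; have [cont _] := cg.
have mA : measurable ([set x | s < g x] : set (borel_rV R d)).
  by apply: open_measurable_rV; exact: continuous_open_gt.
have meq : measurable ([set x | g x = s] : set (borel_rV R d)).
  by apply: measurable_eq_set; exact: continuous_measurable_rV.
have := mu_lim mA (cone_fun_away cg s0); have -> : 
  mu (closure [set x | s < g x] `\` interior [set x | s < g x]) = 0%E.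
  apply/eqP; rewrite eq_le measure_ge0 andbT -null.
  by apply: le_measure; rewrite ?inE //; [exact: measurable_boundary|exact: continuous_boundary].
move=> /(_ erefl); rewrite -(fineK (mass_fin cg s0)) => /fine_cvg.
apply: cvg_trans; apply: near_eq_cvg; near=> t.
have t0 : 0 < t by near: t; exact: nbhs_pinfty_gt.
rewrite /= cone_fun_scale_set // fineM // fin_num_measure //.
exact: measurable_gt_comp.
Unshelve. all: by end_near. Qed.

Lemma cvgy_rescale (f : R -> R) (s l : R) : 0 < s ->
  f t @[t --> +oo] --> l -> f (t * s) @[t --> +oo] --> l.
Proof.
move=> s0 fl; apply: cvg_comp fl => //.
by apply: gt0_cvgMly => //; exact: cvg_id.
Qed.

Section linear_rate.
Variable c : R.
Hypothesis c0 : 0 < c.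
Hypothesis b_lim : b t / t @[t --> +oo] --> c.

(** Substitute u = t s in the limit of b(t) Pr(g(X) > t s). The left-hand side no longer mentions s,
    so s mu{g > s} must be the same at all null levels. *)
Lemma tail_rate g (s : R) : cone_fun g -> 0 < s -> mu [set x | g x = s] = 0%E ->
  u * tail g u @[u --> +oo] --> s * mass g s / c.
Proof.
move=> cg s0 null.
have L : t * s * tail g (t * s) @[t --> +oo] --> s * mass g s / c.
  have : s * ((b t * tail g (t * s)) * (b t / t)^-1) @[t --> +oo] --> s * (mass g s * c^-1).
    apply: cvgMr; apply: cvgM; first exact: tail_lim.
    by apply: cvgV => //; rewrite gt_eqF.
  rewrite mulrA; apply: cvg_trans; apply: near_eq_cvg; near=> t.
  have t0 : 0 < t by near: t; exact: nbhs_pinfty_gt.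
  have bt0 : 0 < b t / t by near: t; apply: (cvgr_gt _ b_lim).
  have b0 : b t != 0.
    by apply: contraTneq bt0 => ->; rewrite mul0r ltxx.
  rewrite invf_div; field; exact: b0.
have s'0 : 0 < s^-1 by rewrite invr_gt0.
have := cvgy_rescale s'0 L.
apply: cvg_trans; apply: near_eq_cvg; near=> t.
by rewrite mulfVK // gt_eqF.
Unshelve. all: by end_near. Qed.

Lemma le_mass g (s s' : R) : cone_fun g -> 0 < s -> s <= s' -> mass g s' <= mass g s.
Proof.
move=> cg s0 ss'; have s'0 := lt_le_trans s0 ss'.
have [cont _] := cg.
have mgt (r : R) : measurable ([set x | r < g x] : set (borel_rV R d)).
  by apply: open_measurable_rV; exact: continuous_open_gt.
apply: fine_le; rewrite ?mass_fin //; apply: le_measure; rewrite ?inE //.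
by move=> x /=; exact: le_lt_trans.
Qed.

Lemma mass_ge0 g s : 0 <= mass g s.
Proof. exact: fine_ge0. Qed.

Lemma cone_fun_null_level g (s s' : R) : cone_fun g -> 0 < s -> s < s' ->
  exists2 r, s < r < s' & mu [set x | g x = r] = 0%E.
Proof.
move=> cg s0 ss'; apply: (@exists_null_level _ _ (borel_rV R d)) => //.
  by apply: continuous_measurable_rV; case: cg.
by rewrite -ge0_fin_numE //; exact: mass_fin.
Qed.

(** Uniqueness of the limit in [tail_rate] gives one constant [K] for all null levels. These are
    dense, and [mass g] is monotone, so no other level can deviate. *)
Lemma mass_homogeneous g (s : R) : cone_fun g -> 0 < s -> s * mass g s = mass g 1.
Proof.
move=> cg s0.
have [K HK] : exists K, forall r, 0 < r -> mu [set x | g x = r] = 0%E -> r * mass g r = K.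
  have [r0 /andP[r00 _] n0] := cone_fun_null_level cg ltr01 (ltr1n R 2).
  exists (r0 * mass g r0) => r rp nr.
  have r00' : 0 < r0 by exact: lt_trans r00.
  have E := cvg_unique (@norm_hausdorff _ _) (tail_rate cg rp nr) (tail_rate cg r00' n0).
  have ci : c^-1 != 0 by rewrite invr_eq0 gt_eqF.
  exact: (mulIf ci (E _)).
have K0 : 0 <= K.
  have [r /andP[r0 _] nr] := cone_fun_null_level cg ltr01 (ltr1n R 2).
  have rp : 0 < r by exact: lt_trans r0.
  by rewrite -(HK r) // mulr_ge0 ?mass_ge0 // ltW.
suff H (r : R) : 0 < r -> r * mass g r = K by rewrite H // -[RHS]mul1r H.
move=> {s s0} r0; apply/eqP; rewrite eq_le; apply/andP; split; rewrite leNgt; apply/negP => lt.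
  have m0 : 0 < mass g r.
    rewrite lt_neqAle mass_ge0 andbT eq_sym; apply: contraTneq lt => ->.
    by rewrite mulr0 -leNgt.
  (* A null level q just below r with K < q mass g r would have less mass than r. The bound r / 2
     keeps q positive when K = 0. *)
  have Kr : Num.max (r / 2) (K / mass g r) < r.
    by rewrite gt_max ltr_pdivrMr // ltr_pMr ?ltr1n //= ltr_pdivrMr.
  have mx0 : 0 < Num.max (r / 2) (K / mass g r) by rewrite lt_max divr_gt0.
  have [q /andP[+ qr] nq] := cone_fun_null_level cg mx0 Kr.
  rewrite gt_max => /andP[rq Kq].
  have q0 : 0 < q by apply: lt_trans rq; rewrite divr_gt0.
  move: Kq; rewrite ltr_pdivrMr // -(HK q) // ltr_pM2l // ltNge le_mass //.
  exact: ltW.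
pose m := mass g r.
have m0 : 0 <= m by exact: mass_ge0.
(* Chosen so that (r + e) m < K, which a null level in ]r, r + e[ contradicts. The denominator is m
   + 1 because m may be 0. *)
pose e := (K - r * m) / (m + 1).
have e0 : 0 < e by rewrite divr_gt0 ?subr_gt0 // ltr_wpDl.
have re : r < r + e by rewrite ltrDl.
have [q /andP[rq qe] nq] := cone_fun_null_level cg r0 re.
have q0 : 0 < q by exact: lt_trans rq.
have : q * mass g q <= q * m by rewrite ler_pM2l // le_mass // ltW.
rewrite HK //; apply/negP; rewrite -ltNge.
apply: (@le_lt_trans _ _ ((r + e) * m)); first by rewrite ler_wpM2r // ltW.
have : e * (m + 1) = K - r * m by rewrite mulfVK // gt_eqF // ltr_wpDl.
by rewrite -/m in lt *; nra.
Qed.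

(** By homogeneity mu{g > s} is a constant over s, hence continuous in s: it has no jump. *)
Lemma mass_null_level g (s : R) : cone_fun g -> 0 < s -> mu [set x | g x = s] = 0%E.
Proof.
move=> cg s0; have [cont _] := cg.
have meq : measurable ([set x | g x = s] : set (borel_rV R d)).
  by apply: measurable_eq_set; exact: continuous_measurable_rV.
have mgt (r : R) : measurable ([set x | r < g x] : set (borel_rV R d)).
  by apply: open_measurable_rV; exact: continuous_open_gt.
have fe : mu [set x | g x = s] \is a fin_num.
  have h0 : 0 < s / 2 by rewrite divr_gt0.
  have := mass_fin cg h0; rewrite !ge0_fin_numE //; apply: le_lt_trans.
  apply: le_measure; rewrite ?inE // => x /= ->.
  by rewrite ltr_pdivrMr // ltr_pMr ?ltr1n.
apply/eqP; rewrite eq_le measure_ge0 andbT -(fineK fe) lee_fin.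
rewrite leNgt; apply/negP; set e := fine _ => e0.
have H r : 0 < r < s -> e <= mass g 1 * (r^-1 - s^-1).
  move=> /andP[r0 rs].
  rewrite mulrBr -[in X in X - _](mass_homogeneous cg r0) -[in X in _ - X](mass_homogeneous cg s0).
  rewrite [r * _]mulrC [s * _]mulrC !mulfK ?gt_eqF // lerBrDr -fineD ?mass_fin //.
  apply: fine_le; rewrite ?fin_numD ?fe ?mass_fin //.
  rewrite -measureU //; [|by apply/seteqP; split => // x [/= ->]; rewrite ltxx].
  apply: le_measure; rewrite ?inE //; first exact: measurableU.
  by move=> x [/= ->|/=] //; exact: lt_trans.
pose K := mass g 1; have K0 : 0 <= K by exact: mass_ge0.
(* Applied at 1/r = 1/s + dl, the bound [H] reads e <= K dl, and this [dl] makes K dl < e. *)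
pose dl := e / (2 * (K + 1)).
have K1 : 0 < 2 * (K + 1) by rewrite mulr_gt0 // ltr_wpDl.
have dl0 : 0 < dl by rewrite divr_gt0.
have i0 : 0 < s^-1 by rewrite invr_gt0.
have := H (s^-1 + dl)^-1; rewrite invrK addrAC subrr add0r => /(_ _)/wrap[].
  rewrite invr_gt0 addr_gt0 //= -[ltRHS]invrK ltf_pV2 ?posrE ?addr_gt0 //.
  by rewrite ltrDl.
apply/negP; rewrite -ltNge -/K.
have : dl * (2 * (K + 1)) = e by rewrite mulfVK // gt_eqF.
by nra.
Qed.

(** * Additivity of the limit mass *)

Section additivity.
Variables f g : 'rV[R]_d -> R.
Hypotheses (cf : cone_fun f) (cg : cone_fun g).
Hypotheses (f0 : forall x, 0 <= f x) (g0 : forall x, 0 <= g x).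
Let r x := f x + g x.

Let cr : cone_fun r. Proof. exact: cone_funD. Qed.

Let above (l s : R) : set (borel_rV R d) := [set x | s < r x /\ l * r x < f x].

Let cell (l l' : R) : set (borel_rV R d) := [set x | l * r x < f x <= l' * r x].

Let measurable_lt (u v : 'rV[R]_d -> R) : cone_fun u -> cone_fun v ->
  measurable ([set x | u x < v x] : set (borel_rV R d)).
Proof.
move=> cu cv; apply: open_measurable_rV.
rewrite [X in open X](_ : _ = [set x | 0 < v x + -1 * u x]).
  by apply: continuous_open_gt; case: (cone_funD cv (cone_funZ (-1) cu)).
by apply/seteqP; split => x /=; rewrite mulN1r subr_gt0.
Qed.

Let measurable_gt (u : 'rV[R]_d -> R) (s : R) : cone_fun u ->
  measurable ([set x | s < u x] : set (borel_rV R d)).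
Proof. by move=> [cu _]; apply: open_measurable_rV; exact: continuous_open_gt. Qed.

Let measurable_above l s : measurable (above l s).
Proof.
by apply: measurableI; [exact: measurable_gt|apply: measurable_lt => //; exact: cone_funZ].
Qed.

Let measurable_cell l l' : measurable (cell l l').
Proof.
rewrite (_ : cell l l' = [set x | l * r x < f x] `\` [set x | l' * r x < f x]).
  by apply: measurableD; apply: measurable_lt => //; exact: cone_funZ.
apply/seteqP; split => x /=; first by move=> /andP[-> H]; split => //; apply/negP; rewrite -leNgt.
by rewrite /cell /= => -[-> /negP]; rewrite -leNgt => ->.
Qed.

Let above_fin l s : 0 < s -> mu (above l s) \is a fin_num.
Proof.
move=> s0; rewrite ge0_fin_numE //; have := mass_fin cr s0; rewrite ge0_fin_numE //.
apply: le_lt_trans; apply: le_measure; rewrite ?inE //; last by move=> x [].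
exact: measurable_gt.
Qed.

(* Exhausting an open cone by superlevel sets of cone functions transfers to it
   the scaling of mass_homogeneous. *)
Let above_bigcup (l s : R) : 0 < s ->
  above l s = \bigcup_n [set x | s < Num.min (r x) (n%:R * (f x + - l * r x))].
Proof.
move=> s0; apply/seteqP; split => [x [sr lf]|x [n _ /=]].
  have p : 0 < f x + - l * r x by rewrite mulNr subr_gt0.
  exists (Num.truncn (s / (f x + - l * r x))).+1 => //=.
  by rewrite lt_min sr -ltr_pdivrMr // truncnS_gt.
rewrite lt_min => /andP[sr sn]; split => //.
have : 0 < n%:R * (f x + - l * r x) by exact: lt_trans sn.
case: n {sn} => [|n]; first by rewrite mul0r ltxx.
by rewrite pmulr_rgt0 // mulNr subr_gt0.
Qed.

Let mass_above (l s : R) : 0 < s ->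
  mass (fun x => Num.min (r x) (n%:R * (f x + - l * r x))) s @[n --> \oo]
    --> fine (mu (above l s)).
Proof.
move=> s0; apply: fine_cvg; rewrite fineK ?above_fin // above_bigcup //.
have cn n : cone_fun (fun x => Num.min (r x) (n%:R * (f x + - l * r x))).
  by apply: cone_fun_min => //; apply: cone_funZ; apply: cone_funD => //; exact: cone_funZ.
apply: nondecreasing_cvg_mu.
- by move=> n; exact: measurable_gt.
- by apply: bigcup_measurable => n _; exact: measurable_gt.
move=> n m nm; apply/subsetPset => x /=; rewrite !lt_min => /andP[-> sn] /=.
apply: (lt_le_trans sn); rewrite ler_wpM2r ?ler_nat //.
rewrite leNgt; apply/negP => neg.
have := lt_trans s0 sn; rewrite ltNge => /negP; apply.
by rewrite mulr_ge0_le0 // ltW.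
Qed.

Let above_homogeneous (l s : R) : 0 < s -> s * fine (mu (above l s)) = fine (mu (above l 1)).
Proof.
move=> s0; have cn n : cone_fun (fun x => Num.min (r x) (n%:R * (f x + - l * r x))).
  by apply: cone_fun_min => //; apply: cone_funZ; apply: cone_funD => //; exact: cone_funZ.
have H1 := @mass_above l 1 ltr01.
have H2 : s * mass (fun x => Num.min (r x) (n%:R * (f x + - l * r x))) s @[n --> \oo]
    --> s * fine (mu (above l s)) by apply: cvgMr; exact: mass_above.
have E : (fun n : nat => s * mass (fun x => Num.min (r x) (n%:R * (f x + - l * r x))) s) =
         (fun n : nat => mass (fun x => Num.min (r x) (n%:R * (f x + - l * r x))) 1).
  by apply/funext => n; exact: mass_homogeneous.
rewrite E in H2; exact: (cvg_unique (@norm_hausdorff _ _) H2 H1).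
Qed.

(** A cell is the difference of two nested open cones, each of which scales. *)
Let cell_homogeneous (l l' s : R) : l <= l' -> 0 < s ->
  s * fine (mu ([set x | s < r x] `&` cell l l')) = fine (mu ([set x | 1 < r x] `&` cell l l')).
Proof.
move=> ll'.
have H (q : R) : 0 < q ->
    fine (mu ([set x | q < r x] `&` cell l l')) = fine (mu (above l q)) - fine (mu (above l' q)).
  move=> q0; have -> : [set x | q < r x] `&` cell l l' = above l q `\` above l' q.
    apply/seteqP; split => x /=.
      move=> [qr /andP[lf fl']]; split; first by [].
      by move=> [_]; rewrite ltNge fl'.
    move=> [[qr lf] n]; split => //; rewrite /cell /= lf leNgt; apply/negP => l'f.
    exact: n.
  rewrite measureD //.
    rewrite setIidr ?fineB ?above_fin //.
    move=> x [qr l'f]; split => //; apply: le_lt_trans l'f.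
    by rewrite ler_wpM2r // ltW // (lt_trans q0).
  by rewrite -ge0_fin_numE // above_fin.
by move=> s0; rewrite !H // mulrBr !above_homogeneous.
Qed.

Let cell_fin (l l' s : R) u : cone_fun u -> 0 < s ->
  mu ([set x | s < u x] `&` cell l l') \is a fin_num.
Proof.
move=> cu s0; rewrite ge0_fin_numE //; have := mass_fin cu s0; rewrite ge0_fin_numE //.
apply: le_lt_trans; apply: le_measure; rewrite ?inE //.
  by apply: measurableI => //; exact: measurable_gt.
exact: measurable_gt.
Qed.

(** For positive [alpha] and [beta], inside the cell {u > 1} contains {r > 1/alpha} and is contained
    in {r > 1/beta}, and [cell_homogeneous] turns these into multiples of the mass of {r > 1}. The
    other signs do occur, in the first and last cells of the mesh. *)
Let cell_bounds u (l l' alpha beta : R) : cone_fun u -> l <= l' -> 0 <= beta ->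
  (forall x, cell l l' x -> alpha * r x <= u x <= beta * r x) ->
  alpha * fine (mu ([set x | 1 < r x] `&` cell l l'))
    <= fine (mu ([set x | 1 < u x] `&` cell l l'))
    <= beta * fine (mu ([set x | 1 < r x] `&` cell l l')).
Proof.
move=> cu ll' beta0 H.
have r0 x : 0 <= r x by rewrite addr_ge0.
have m1 : measurable ([set x | 1 < u x] `&` cell l l' : set (borel_rV R d)).
  by apply: measurableI => //; exact: measurable_gt.
apply/andP; split.
  have [a0|a0] := leP alpha 0.
    by apply: (@le_trans _ _ 0) => //; rewrite mulr_le0_ge0 ?fine_ge0.
  have ai : 0 < alpha^-1 by rewrite invr_gt0.
  rewrite -(cell_homogeneous ll' ai) mulrA divff ?gt_eqF // mul1r.
  apply: fine_le; rewrite ?cell_fin //; apply: le_measure; rewrite ?inE //.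
    by apply: measurableI => //; exact: measurable_gt.
  move=> x [/= ar cx]; split => //=; have /andP[+ _] := H _ cx.
  by apply: lt_le_trans; rewrite mulrC -ltr_pdivrMr // div1r.
have [b0|b0] := leP beta 0.
  rewrite [X in fine (mu X) <= _](_ : _ = set0) ?measure0 ?mulr_ge0 ?fine_ge0 //.
  rewrite -subset0 => x [/= u1 cx]; have /andP[_ +] := H _ cx.
  apply/negP; rewrite -ltNge; apply: le_lt_trans (lt_trans ltr01 u1).
  by rewrite mulr_le0_ge0.
have bi : 0 < beta^-1 by rewrite invr_gt0.
rewrite -(cell_homogeneous ll' bi) mulrA divff ?gt_eqF // mul1r.
apply: fine_le; rewrite ?cell_fin //; apply: le_measure; rewrite ?inE //.
  by apply: measurableI => //; exact: measurable_gt.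
move=> x [/= u1 cx]; split => //=; have /andP[_ +] := H _ cx.
move=> ur; have := lt_le_trans u1 ur.
by rewrite -div1r ltr_pdivrMr // mulrC.
Qed.

Let cell_sum u (l : nat -> R) (n : nat) : cone_fun u -> (forall k, l k <= l k.+1) ->
  fine (mu ([set x | 1 < u x] `&` cell (l 0%N) (l n))) =
  \sum_(k < n) fine (mu ([set x | 1 < u x] `&` cell (l k) (l k.+1))).
Proof.
move=> cu hl.
have r0 x : 0 <= r x by rewrite addr_ge0.
have m1 a b' : measurable ([set x | 1 < u x] `&` cell a b' : set (borel_rV R d)).
  by apply: measurableI => //; exact: measurable_gt.
elim: n => [|n IH].
  rewrite big_ord0 (_ : _ `&` _ = set0) ?measure0 //.
  rewrite -subset0 => x [_ /=]; rewrite /cell /= => /andP[H1 H2].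
  by move: (lt_le_trans H1 H2); rewrite ltxx.
have l0n : l 0%N <= l n by elim: n {IH} => // n IH; exact: le_trans (hl n).
rewrite big_ord_recr /= -IH -fineD ?cell_fin // -measureU //.
  congr (fine (mu _)); rewrite -setIUr; congr (_ `&` _).
  apply/seteqP; split => x; rewrite /cell /=.
    move=> /andP[H1 H2]; have [H|H] := leP (f x) (l n * r x); [left|right].
      by rewrite H1.
    by rewrite H2.
  move=> [] /andP[H1 H2].
    by rewrite H1 (le_trans H2) // ler_wpM2r.
  by rewrite H2 andbT (le_lt_trans _ H1) // ler_wpM2r.
rewrite -subset0 => x [[_ /andP[_ H2]] [_ /andP[H1 _]]].
by move: (lt_le_trans H1 H2); rewrite ltxx.
Qed.

Lemma mass_add : mass r 1 = mass f 1 + mass g 1.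
Proof.
have r0 x : 0 <= r x by rewrite addr_ge0.
pose A n := mass r 1 / n.+1%:R.
have K n : mass f 1 + mass g 1 - A n <= mass r 1 <= mass f 1 + mass g 1 + A n.
  (* The mesh starts below 0 because cells are open on the left and must still catch the points
     where f = 0; after n + 2 cells it ends at 1, where f = r. *)
  pose l (k : nat) : R := (k%:R - 1) / n.+1%:R.
  have n0 : 0 < n.+1%:R :> R by [].
  have hl k : l k <= l k.+1 by rewrite ler_pM2r ?invr_gt0 // lerD2r ler_nat.
  have lS k : l k.+1 = l k + n.+1%:R^-1 by rewrite /l -natr1; field.
  have lSE k : l k.+1 = k%:R / n.+1%:R by rewrite /l -natr1 addrK.
  have all u : (forall x, u x <= r x) ->
      [set x | 1 < u x] `&` cell (l 0%N) (l n.+2) = [set x | 1 < u x].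
    move=> ur; apply/seteqP; split => [x []//|x /= u1]; split => //.
    have rp : 0 < r x by apply: lt_le_trans (ur x); exact: lt_trans u1.
    rewrite /cell /= lSE divff ?gt_eqF // mul1r /l sub0r mulNr div1r mulNr.
    rewrite lerDl g0 andbT; apply: lt_le_trans (f0 x).
    by rewrite oppr_lt0 mulr_gt0 ?invr_gt0.
  have allE u : cone_fun u -> (forall x, u x <= r x) -> mass u 1 =
      \sum_(k < n.+2) fine (mu ([set x | 1 < u x] `&` cell (l k) (l k.+1))).
    by move=> cu ur; rewrite -cell_sum // all.
  pose S k := fine (mu ([set x | 1 < r x] `&` cell (l k) (l k.+1))).
  have F (k : 'I_n.+2) : l k * S k <= fine (mu ([set x | 1 < f x] `&` cell (l k) (l k.+1)))
      <= l k.+1 * S k.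
    apply: cell_bounds => //; first by rewrite lSE divr_ge0.
    by move=> x; rewrite /cell /= => /andP[/ltW -> ->].
  have G (k : 'I_n.+2) : (1 - l k.+1) * S k
      <= fine (mu ([set x | 1 < g x] `&` cell (l k) (l k.+1))) <= (1 - l k) * S k.
    apply: cell_bounds => //.
      rewrite subr_ge0 /l ler_pdivrMr // mul1r lerBlDr natr1 ler_nat.
      by rewrite (leq_trans (ltnW (ltn_ord k))) // .
    move=> x; rewrite /cell /= => /andP[/ltW H1 H2].
    have -> : g x = r x - f x by rewrite /r addrC addKr.
    by rewrite !mulrBl !mul1r !lerD2l !lerN2 H1 H2.
  (* On each cell the error is the mesh width times the mass of {r > 1} there, so the errors add up
     to [A n]. *)
  have Ar : A n = \sum_(k < n.+2) n.+1%:R^-1 * S k.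
    by rewrite -mulr_sumr -allE // mulrC.
  have fr x : f x <= r x by rewrite lerDl.
  have gr x : g x <= r x by rewrite lerDr.
  rewrite Ar (allE r) // (allE f) // (allE g) //.
  have aux (a a' q s p p' : R) : a' = a + q -> a * s <= p <= a' * s ->
      (1 - a') * s <= p' <= (1 - a) * s -> p + p' - q * s <= s <= p + p' + q * s.
    move=> ->; rewrite !mulrBl !mulrDl !mul1r => /andP[h1 h2] /andP[h3 h4].
    by apply/andP; split; lra.
  rewrite -sumrN -!big_split /=; apply/andP; split; apply: ler_sum => k _;
    by have /andP[] := aux _ _ _ _ _ _ (lS k) (F k) (G k).
have H x y : (forall n, x <= y + A n) -> x <= y.
  move=> xy; rewrite leNgt; apply/negP => yx.
  have xy0 : 0 < x - y by rewrite subr_gt0.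
  have := truncnS_gt (mass r 1 / (x - y)); rewrite ltr_pdivrMr //.
  rewrite mulrC -ltr_pdivrMr // ltNge lerBlDl => /negP; apply.
  exact: xy.
apply/eqP; rewrite eq_le; apply/andP; split; apply: H => n.
  by have /andP[] := K n.
by rewrite -lerBlDr; have /andP[] := K n.
Qed.

End additivity.

Lemma mass_scale (k : R) f : cone_fun f -> 0 <= k ->
  mass (fun x => k * f x) 1 = k * mass f 1.
Proof.
move=> cf; rewrite le_eqVlt => /predU1P[<-|k0].
  rewrite mul0r /mass (_ : [set _ | _] = set0) ?measure0 //.
  by rewrite -subset0 => x /=; rewrite mul0r ltNge ler01.
have ki : 0 < k^-1 by rewrite invr_gt0.
rewrite -(mass_homogeneous cf ki) mulrA divff ?gt_eqF // mul1r.
congr (fine (mu _)); apply/seteqP; split => x /=.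
  by rewrite -[k^-1]div1r ltr_pdivrMr // mulrC.
by rewrite -[k^-1]div1r ltr_pdivrMr // mulrC.
Qed.

Lemma cone_fun_wsum (w : 'I_d -> R) (s : seq 'I_d) :
  cone_fun (fun x : 'rV[R]_d => \sum_(i <- s) w i * Num.max (x 0 i) 0).
Proof.
elim: s => [|i s IH].
  rewrite [X in cone_fun X](_ : _ = fun=> 0); first exact: cone_fun_cst0.
  by apply/funext => x; rewrite big_nil.
rewrite [X in cone_fun X](_ : _ = fun x : 'rV[R]_d =>
    w i * Num.max (x 0 i) 0 + \sum_(j <- s) w j * Num.max (x 0 j) 0).
  by apply: cone_funD => //; apply: cone_funZ; exact: cone_fun_coord_pos.
by apply/funext => x; rewrite big_cons.
Qed.

Lemma mass_wsum (w : 'I_d -> R) (s : seq 'I_d) : (forall i, 0 <= w i) ->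
  mass (fun x => \sum_(i <- s) w i * Num.max (x 0 i) 0) 1 =
  \sum_(i <- s) w i * mass (fun x => Num.max (x 0 i) 0) 1.
Proof.
move=> w0; elim: s => [|i s IH].
  rewrite big_nil /mass (_ : [set _ | _] = set0) ?measure0 //.
  by rewrite -subset0 => x /=; rewrite big_nil ltNge ler01.
rewrite big_cons -IH -mass_scale //; last exact: cone_fun_coord_pos.
rewrite -mass_add.
- by congr (mass _ _); apply/funext => x; rewrite big_cons.
- by apply: cone_funZ; exact: cone_fun_coord_pos.
- exact: cone_fun_wsum.
- by move=> x; rewrite mulr_ge0 // le_max lexx orbT.
- by move=> x; apply: sumr_ge0 => j _; rewrite mulr_ge0 // le_max lexx orbT.
Qed.

End linear_rate.
End regular_variation.

(** * Quantiles and margins *)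

Lemma uniform01E {R : realType} (A : set R) : measurable A ->
  uniform_prob (@ltr01 R) A = lebesgue_measure (A `&` `[0, 1]%classic).
Proof.
move=> mA; rewrite /uniform_prob integral_uniform_pdf.
rewrite (eq_integral (fun=> 1%E)); last first.
  move=> x; rewrite inE => -[_ /=]; rewrite in_itv /= => x01.
  by rewrite /uniform_pdf x01 subr0 invr1.
by rewrite integral_cst ?mul1e //; exact: measurableI.
Qed.

Section quantiles.
Context {R : realType} (F : cumulativeBounded (0 : R) (1 : R)).
Hypothesis F_tail : (1 - F x) / x^-1 @[x --> +oo] --> (1 : R).
Hypothesis F_0minus : F x @[x --> 0^'-] --> (0 : R).

Lemma cdf_nd x y : x <= y -> F x <= F y.
Proof. exact: cumulative_is_nondecreasing. Qed.

(** If F reached 1, then 1 - F would vanish from there on and could not be equivalent to 1/x. *)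
Lemma cdf_lt1 x : F x < 1.
Proof.
near (pinfty_nbhs R) => y.
have y0 : 0 < y by near: y; exact: nbhs_pinfty_gt.
have xy : x <= y by near: y; apply: nbhs_pinfty_ge; exact: num_real.
apply: le_lt_trans (cdf_nd xy) _.
have : 0 < (1 - F y) / y^-1 by near: y; exact: (cvgr_gt _ F_tail).
by rewrite invrK pmulr_lgt0 // subr_gt0.
Unshelve. all: by end_near. Qed.

Lemma cdf_ge0 x : 0 <= F x.
Proof.
rewrite leNgt; apply/negP => Fx0.
near (ninfty_nbhs R) => y.
have yx : y <= x by near: y; apply: nbhs_ninfty_le; exact: num_real.
have : F x < F y by near: y; exact: (cvgr_gt _ (cumulativeNy F)).
by rewrite ltNge cdf_nd.
Unshelve. all: by end_near. Qed.

Lemma cdf_neg x : x < 0 -> F x = 0.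
Proof.
move=> x0; apply/eqP; rewrite eq_le cdf_ge0 andbT leNgt; apply/negP => Fx0.
near (0 : R)^'- => y.
have xy : x <= y by near: y; exact: nbhs_left_ge.
have : F y < F x by near: y; exact: (cvgr_lt _ F_0minus).
by rewrite ltNge cdf_nd.
Unshelve. all: by end_near. Qed.

(** Right continuity of F makes the infimum attained. The set is bounded below by 0 because F
    vanishes on the negative half-line. *)
Lemma quantile_le p x : 0 < p -> p < 1 -> (quantile F p <= x) = (p <= F x).
Proof.
move=> p0 p1; set S := [set y | p <= F y].
have lbS y : S y -> 0 <= y.
  by move=> Sy; rewrite leNgt; apply/negP => y0; move: Sy; rewrite /S /= cdf_neg // leNgt p0.
have hS : has_inf S.
  split; last by exists 0.
  near (pinfty_nbhs R) => y; exists y; apply: ltW.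
  by near: y; exact: (cvgr_gt _ (cumulativey F)).
have pF : p <= F (inf S).
  rewrite leNgt; apply/negP => Fp.
  have e0 : 0 < (p - F (inf S)) / 2 by rewrite divr_gt0 // subr_gt0.
  have [dl Fdl] := nondecreasing_right_continuousP (inf S) F e0.
  have [s Ss sdl] := inf_adherent [elaborate (gt0 dl)] hS.
  have := le_trans Ss (le_trans (cdf_nd (ltW sdl)) Fdl).
  apply/negP; rewrite -ltNge -ltrBrDl ltr_pdivrMr // mulr_natr mulr2n.
  by rewrite ltrDl subr_gt0.
apply/idP/idP => [qx|pFx]; first by apply: le_trans pF _; exact: cdf_nd.
by apply: ge_inf => //; case: hS.
Unshelve. all: by end_near. Qed.

(** The default value of [inf] applies twice: for p <= 0 the set is all of R, for p >= 1 it is empty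
    since F < 1. Knowing this value makes [quantile F] nonnegative and measurable on the whole
    line. *)
Lemma quantile_out p : p <= 0 \/ 1 <= p -> quantile F p = 0.
Proof.
case=> hp; rewrite /quantile.
  rewrite inf_out // => -[_ [l lb]].
  have := lb (l - 1); rewrite /= (le_trans hp) ?cdf_ge0 // => /(_ isT).
  by rewrite lerBrDr gerDl leNgt ltr01.
rewrite (_ : [set _ | _] = set0) ?inf0 //.
by rewrite -subset0 => x /=; rewrite leNgt (lt_le_trans (cdf_lt1 x)).
Qed.

Lemma quantile_gt p t : 0 <= t -> (t < quantile F p) = [&& 0 < p, p < 1 & F t < p].
Proof.
move=> t0; have [p0|p0] := ltP 0 p; last by rewrite quantile_out ?ltNge ?t0 //; left.
have [p1|p1] := ltP p 1; last by rewrite quantile_out ?ltNge ?t0 //; right.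
by rewrite /= !ltNge quantile_le.
Qed.

Lemma quantile_ge0 p : 0 <= quantile F p.
Proof.
have [p0|p0] := leP p 0; first by rewrite quantile_out //; left.
have [p1|p1] := leP 1 p; first by rewrite quantile_out //; right.
rewrite leNgt; apply/negP => q0.
have := quantile_le (quantile F p) p0 p1; rewrite lexx cdf_neg //.
by rewrite leNgt p0.
Qed.

Lemma measurable_quantile : measurable_fun setT (quantile F).
Proof.
apply: (measurability _ (RGenOInfty.measurableE R)) => _ [_ [t ->] <-]; rewrite setTI.
have [t0|t0] := ltP t 0.
  rewrite (_ : _ @^-1` _ = setT) //; apply/seteqP; split => // p _ /=.
  by rewrite in_itv /= andbT (lt_le_trans t0) // quantile_ge0.
rewrite (_ : _ @^-1` _ = `]F t, 1[%classic); first exact: measurable_itv.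
apply/seteqP; split => p /=; rewrite !in_itv /= andbT quantile_gt //.
  by move=> /and3P[_ -> ->].
by move=> /andP[Fp ->]; rewrite Fp andbT (le_lt_trans (cdf_ge0 t)).
Qed.

Lemma uniform_quantile_tail {disp : measure_display} {T : measurableType disp}
    (Pr : probability T R) (U : {RV Pr >-> R}) (t : R) : uniform01 U -> 0 <= t ->
  fine (Pr [set w | t < quantile F (1 - U w)]) = 1 - F t.
Proof.
move=> uU t0; have mI : measurable `]0, 1 - F t[%classic by exact: measurable_itv.
have := uU _ mI; rewrite /distribution /pushforward uniform01E // => E.
have -> : [set w | t < quantile F (1 - U w)] = U @^-1` `]0, 1 - F t[%classic.
  apply/seteqP; split => w /=; rewrite quantile_gt // in_itv /= subr_gt0 gtrBl.
    by move=> /and3P[_ -> Fw]; rewrite ltrBrDr -ltrBrDl.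
  move=> /andP[-> w1]; rewrite (lt_le_trans w1) ?gerBl ?cdf_ge0 //=.
  by rewrite ltrBrDr -ltrBrDl.
rewrite E setIidl; last first.
  move=> x /=; rewrite !in_itv /= => /andP[/ltW -> /ltW xF] /=.
  by rewrite (le_trans xF) // gerBl cdf_ge0.
by rewrite lebesgue_measure_itv /= lte_fin subr_gt0 cdf_lt1 /= subr0.
Qed.

(** A bound for all u, not only near 0: it will provide the dominating function in the limit along a
    ray. *)
Lemma quantile_bound : exists2 C : R, 0 < C & forall u, 0 < u -> u * quantile F (1 - u) <= C.
Proof.
have [M [M0 HM]] : exists M : R, 0 < M /\ forall x, M <= x -> (1 - F x) * x <= 2.
  have : \forall x \near +oo, (1 - F x) / x^-1 < 2 by apply: (cvgr_lt _ F_tail); rewrite ltr1n.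
  move=> [M [_ HM]]; exists (Num.max 1 (M + 1)); split; first by rewrite lt_max ltr01.
  move=> x; rewrite ge_max => /andP[_ Mx].
  by have := HM x; rewrite /= invrK => /(_ _)/ltW; apply; rewrite (lt_le_trans _ Mx) // ltrDl.
exists (2 + M); first by rewrite addr_gt0.
move=> u u0; have [u1|u1] := leP 1 u.
  rewrite quantile_out; last by left; rewrite subr_le0.
  by rewrite mulr0 addr_ge0 // ltW.
rewrite mulrC -ler_pdivlMr // quantile_le ?subr_gt0 // ?gtrBl //.
rewrite lerBlDr -lerBlDl.
(* With this x the claim is 1 - F x <= u. If x >= M it follows from (1 - F x) x <= 2 <= u x; if x <
   M then u x = 2 + M exceeds x, so u >= 1 >= 1 - F x. *)
set x := (2 + M) / u.
have x0 : 0 < x by rewrite divr_gt0 // addr_gt0.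
have ux : u * x = 2 + M by rewrite mulrC mulfVK // gt_eqF.
have [Mx|xM] := leP M x.
  by rewrite -(ler_pM2r x0) ux; apply: le_trans (HM _ Mx) _; rewrite lerDl ltW.
apply: (@le_trans _ _ 1); first by rewrite gerBl cdf_ge0.
rewrite -(ler_pM2r x0) ux mul1r (le_trans (ltW xM)) // lerDr //.
Qed.

(** Inversion of 1 - F(x) ~ 1/x: evaluating F at (1 + e/2)/u and (1 - e/2)/u encloses the quantile
    through the equivalence between [quantile F p <= x] and [p <= F x]. *)
Lemma quantile_equiv : u * quantile F (1 - u) @[u --> 0^'+] --> (1 : R).
Proof.
have near_x (P : R -> Prop) (a : R) : 0 < a -> (\forall x \near +oo, P x) ->
    \forall u \near (0 : R)^'+, P (a / u).
  move=> a0 [M [_ HM]].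
  have M0 : 0 < Num.max M 1 by rewrite lt_max ltr01 orbT.
  near=> u.
  have u0 : 0 < u by near: u; exact: nbhs_right_gt.
  apply: HM; rewrite ltr_pdivlMr //.
  apply: (@le_lt_trans _ _ (Num.max M 1 * u)); first by rewrite ler_pM2r // le_max lexx.
  rewrite mulrC -ltr_pdivlMr //; near: u; apply: nbhs_right_lt; exact: divr_gt0.
apply/cvgrPdist_lt => e e0.
(* Capped at 1/2 so that the lower test point (1 - e1/2)/u is positive. *)
pose e1 := Num.min e (2^-1).
have e10 : 0 < e1 by rewrite lt_min e0 invr_gt0 ltr0n.
have e1e : e1 <= e by rewrite ge_min lexx.
have e11 : e1 <= 2^-1 by rewrite ge_min lexx orbT.
have p0 : 0 < 1 + e1 / 2 by rewrite addr_gt0 // divr_gt0.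
have q0 : 0 < 1 - e1 / 2 by lra.
near=> u.
have u0 : 0 < u by near: u; exact: nbhs_right_gt.
have u1 : u < 1 by near: u; apply: nbhs_right_lt.
have up : quantile F (1 - u) <= (1 + e1 / 2) / u.
  rewrite quantile_le ?subr_gt0 // ?gtrBl // lerBlDr -lerBlDl.
  suff : (1 - F ((1 + e1 / 2) / u)) / ((1 + e1 / 2) / u)^-1 < 1 + e1 / 2.
    by rewrite invrK mulrA ltr_pdivrMr // [_ * u]mulrC ltr_pM2r // => /ltW.
  near: u; apply: (near_x (fun x => (1 - F x) / x^-1 < 1 + e1 / 2)) => //.
  by apply: (cvgr_lt _ F_tail); rewrite ltrDl divr_gt0.
have lo : (1 - e1 / 2) / u < quantile F (1 - u).
  rewrite quantile_gt ?divr_ge0 ?ltW // subr_gt0 u1 gtrBl u0 /=.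
  rewrite ltrBrDr -ltrBrDl.
  suff : 1 - e1 / 2 < (1 - F ((1 - e1 / 2) / u)) / ((1 - e1 / 2) / u)^-1.
    by rewrite invrK mulrA ltr_pdivlMr // [_ * u]mulrC ltr_pM2r.
  near: u; apply: (near_x (fun x => 1 - e1 / 2 < (1 - F x) / x^-1)) => //.
  by apply: (cvgr_gt _ F_tail); rewrite gtrBl divr_gt0.
move: up lo; rewrite ler_pdivlMr // ltr_pdivrMr // [_ * u]mulrC => up lo.
by rewrite ltr_distl; apply/andP; split; lra.
Unshelve. all: by end_near. Qed.

End quantiles.

(** * Convex combinations are calibrated *)

Section linear_is_calibrated.
Context {R : realType} {d : nat} (hd : (0 < d)%N) (F : cumulativeBounded (0 : R) (1 : R)).
Hypothesis F_tail : (1 - F x) / x^-1 @[x --> +oo] --> (1 : R).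
Hypothesis F_0minus : F x @[x --> 0^'-] --> (0 : R).

Lemma test_vector_ge0 (T : Type) (P : 'I_d -> T -> R) w : orthant (test_vector F P w).
Proof. by move=> i; rewrite mxE quantile_ge0. Qed.

Lemma cone_fun_norm : cone_fun (fun x : 'rV[R]_d => `|x|).
Proof.
split; first exact: norm_continuous.
by move=> a x a0; rewrite normrZ gtr0_norm.
Qed.

Section fixed_sample.
Context {disp : measure_display} {T : measurableType disp} (Pr : probability T R).
Variable P : 'I_d -> {RV Pr >-> R}.
Hypothesis uP : forall i, uniform01 (P i).
Let X := test_vector F (fun i => P i : T -> R).

Lemma tail_coord i (t : R) : 0 <= t ->
  tail Pr X (fun x => Num.max (x 0 i) 0) t = 1 - F t.
Proof.
move=> t0; rewrite -(uniform_quantile_tail F_tail F_0minus (uP i) t0) /tail.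
congr (fine (Pr _)); apply/seteqP; split => w /=;
  by rewrite mxE (max_idPl _) ?quantile_ge0.
Qed.

Lemma tail_coord_rate i :
  t * tail Pr X (fun x => Num.max (x 0 i) 0) t @[t --> +oo] --> (1 : R).
Proof.
apply: cvg_trans F_tail; apply: near_eq_cvg; near=> t.
have t0 : 0 < t by near: t; exact: nbhs_pinfty_gt.
by rewrite tail_coord ?ltW // invrK mulrC.
Unshelve. all: by end_near. Qed.

Hypothesis mX : measurable_fun [set: T] (X : T -> borel_rV R d).

(** Union bound: the norm is the maximum norm, so a large vector has a large coordinate. Through it
    the margins control all of [mu]. *)
Lemma tail_norm_le (t : R) : 0 <= t -> tail Pr X (fun x => `|x|) t <= d%:R * (1 - F t).
Proof.
move=> t0.
have mc i : measurable [set w | t < X w 0 i].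
  by apply: (measurable_gt_comp mX (g := fun x : 'rV[R]_d => x 0 i)); exact: coord_continuous.
have bound (s : seq 'I_d) : measurable [set w | exists2 i, i \in s & t < X w 0 i] /\
    (Pr [set w | exists2 i, i \in s & (t < X w 0 i)%R] <= ((size s)%:R * (1 - F t))%:E)%E.
  elim: s => [|i s [ms IH]].
    rewrite (_ : [set _ | _] = set0); first by rewrite measure0 mul0r.
    by rewrite -subset0 => w [].
  have -> : [set w | exists2 j, j \in i :: s & t < X w 0 j] =
      [set w | t < X w 0 i] `|` [set w | exists2 j, j \in s & t < X w 0 j].
    apply/seteqP; split => w /=.
      by move=> [j + tj]; rewrite inE => /predU1P[<-|js]; [left|right; exists j].
    move=> [ti|[j js tj]]; first by exists i; rewrite ?mem_head.
    by exists j; rewrite // inE js orbT.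
  split; first exact: measurableU.
  apply: (le_trans (measureU2 _ (mc i) ms)).
  rewrite /= -natr1 mulrDl mul1r addrC EFinD; apply: leeD => //.
  rewrite -(fineK (fin_num_measure _ _ (mc i))) lee_fin -(tail_coord i t0) /tail.
  rewrite le_eqVlt; apply/orP; left; apply/eqP; congr (fine (Pr _)); apply/seteqP; split => w /=;
    by rewrite mxE (max_idPl _) ?quantile_ge0.
have [ms Hs] := bound (enum 'I_d).
rewrite size_enum_ord in Hs.
rewrite /tail -lee_fin fineK; last first.
  by apply: fin_num_measure; apply: (measurable_gt_comp mX (g := fun x : 'rV[R]_d => `|x|)); exact: norm_continuous.
apply: le_trans Hs; apply: le_measure; rewrite ?inE //.
  by apply: (measurable_gt_comp mX (g := fun x : 'rV[R]_d => `|x|)); exact: norm_continuous.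
move=> w /= tX; have nz : `|X w| != 0 by rewrite gt_eqF // (le_lt_trans t0).
have [[i j] /= E] := mx_norm_neq0 nz.
exists j; first by rewrite mem_enum.
move: tX; rewrite [X in _ < X]E (ord1 i) ger0_norm //.
exact: test_vector_ge0.
Qed.

Variables (b : R -> R) (mu : {measure set (borel_rV R d) -> \bar R}).
Hypothesis b_gt0 : forall t, 0 < t -> 0 < b t.
Hypothesis mu0 : mu [set 0] = 0%E.
Hypothesis muT : mu [set: 'rV[R]_d] <> 0%E.
Hypothesis mu_fin : forall A : set (borel_rV R d), measurable A -> bounded_away0 A ->
  (mu A < +oo)%E.
Hypothesis mu_lim : forall A : set (borel_rV R d), measurable A -> bounded_away0 A ->
  mu (closure (A : set 'rV[R]_d) `\` interior (A : set 'rV[R]_d)) = 0%E ->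
  ((b t)%:E * Pr (X @^-1` [set t *: x | x in (A : set 'rV[R]_d)]))%E
    @[t --> +oo] --> mu A.

(** For one coordinate, b(t) Pr(X_i > t s) has a limit by regular variation and t s Pr(X_i > t s)
    tends to 1 by the known margin; the quotient gives b(t)/t. *)
Lemma scaling_rate : exists2 c : R, 0 < c & b t / t @[t --> +oo] --> c.
Proof.
pose x_ i := fun x : 'rV[R]_d => Num.max (x 0 i) 0.
have cx i : cone_fun (x_ i) by exact: cone_fun_coord_pos.
have i0 : 'I_d := Ordinal hd.
have [s /andP[s1 _] ns] := cone_fun_null_level mu_fin (cx i0) ltr01 (ltr1n R 2).
have s0 : 0 < s by exact: lt_trans s1.
pose c := s * mass mu (x_ i0) s.
have bl : b t / t @[t --> +oo] --> c.
  have L1 := tail_lim mX mu_fin mu_lim (cx i0) s0 ns.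
  have L2 := cvgy_rescale s0 (tail_coord_rate i0).
  have : s * ((b t * tail Pr X (x_ i0) (t * s)) / (t * s * tail Pr X (x_ i0) (t * s)))
      @[t --> +oo] --> s * (mass mu (x_ i0) s / 1).
    by apply: cvgMr; apply: cvgM => //; apply: cvgV => //; rewrite oner_neq0.
  rewrite divr1; apply: cvg_trans; apply: near_eq_cvg; near=> t.
  have t0 : 0 < t by near: t; exact: nbhs_pinfty_gt.
  have q0 : tail Pr X (x_ i0) (t * s) != 0.
    by rewrite tail_coord ?subr_eq0 ?gt_eqF ?cdf_lt1 // mulr_ge0 // ltW.
  by field; rewrite q0 !gt_eqF.
have : 0 <= c by rewrite mulr_ge0 ?mass_ge0 // ltW.
rewrite le_eqVlt => /predU1P[c0|c0]; last by exists c.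
exfalso; apply: muT.
(* If c = 0, [tail_norm_le] bounds mu{|x| > q} by the limit of d (b(t)/t) / q, which is 0. These
   sets together with {0} exhaust the space. *)
have null (n : nat) : mu [set x | (n.+1%:R^-1 < `|x|)%R] = 0%E.
  pose e : R := n.+1%:R^-1.
  have e0 : 0 < e / 2 by rewrite divr_gt0 // invr_gt0.
  have e2 : e / 2 < e by rewrite ltr_pdivrMr // ltr_pMr ?ltr1n // invr_gt0.
  have [q /andP[q1 q2] nq] := cone_fun_null_level mu_fin cone_fun_norm e0 e2.
  have q0 : 0 < q by exact: lt_trans q1.
  have L1 := tail_lim mX mu_fin mu_lim cone_fun_norm q0 nq.
  have L2 := cvgy_rescale q0 (tail_coord_rate i0).
  have L3 : d%:R * ((b t / t) * (t * q * tail Pr X (x_ i0) (t * q)) / q) @[t --> +oo]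
      --> d%:R * (c * 1 / q).
    apply: cvgMr; apply: cvgM; last exact: cvg_cst.
    exact: cvgM.
  rewrite -c0 mul0r mul0r mulr0 in L3.
  have le0 : mass mu (fun x => `|x|) q <= 0.
    apply: ler_cvg_to L1 L3 _.
    near=> t.
    have t0 : 0 < t by near: t; exact: nbhs_pinfty_gt.
    have tq : 0 <= t * q by rewrite mulr_ge0 // ltW.
    apply: (@le_trans _ _ (b t * (d%:R * (1 - F (t * q))))).
      by rewrite ler_pM2l ?b_gt0 //; exact: tail_norm_le.
    rewrite tail_coord // le_eqVlt; apply/orP; left; apply/eqP.
    by field; rewrite !gt_eqF.
  have f := mass_fin mu_fin cone_fun_norm q0.
  apply/eqP; rewrite eq_le measure_ge0 andbT.
  apply: (@le_trans _ _ (mu [set x | (q < `|x|)%R])).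
    have mn (r : R) : measurable ([set x | r < `|x|] : set (borel_rV R d)).
      by apply: open_measurable_rV; apply: continuous_open_gt; exact: norm_continuous.
    apply: le_measure; rewrite ?inE //.
    by move=> x /=; apply: lt_trans; exact: q2.
  by rewrite -(fineK f) lee_fin.
have -> : [set: 'rV[R]_d] = [set 0] `|` \bigcup_n [set x | n.+1%:R^-1 < `|x|].
  apply/seteqP; split => // x _; have [->|x0] := eqVneq x 0; [by left|right].
  have x0' : 0 < `|x| by rewrite normr_gt0.
  exists (Num.truncn (`|x|^-1)) => //=.
  by rewrite -[ltRHS]invrK ltf_pV2 ?posrE ?invr_gt0 // truncnS_gt.
have mn (r : R) : measurable ([set x | r < `|x|] : set (borel_rV R d)).
  by apply: open_measurable_rV; apply: continuous_open_gt; exact: norm_continuous.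
have m0 : measurable ([set 0] : set (borel_rV R d)).
  rewrite -[X in measurable X]setCK; apply: measurableC; apply: open_measurable_rV.
  by rewrite openC; exact: (accessible_closed_set1 (hausdorff_accessible (@norm_hausdorff _ _))).
have N : mu.-negligible ([set 0] `|` \bigcup_n [set x : borel_rV R d | n.+1%:R^-1 < `|x : 'rV[R]_d|]).
  apply: negligibleU; first by apply/(negligibleP mu m0).
  apply: negligible_bigcup => n.
  exact: ((negligibleP mu (mn n.+1%:R^-1)).2 (null n)).
apply: measure_negligible N.
by apply: measurableU => //; exact: bigcup_measurable.
Unshelve. all: by end_near. Qed.

Lemma linear_tail_ratio (w : 'I_d -> R) (h : 'rV[R]_d -> R) :
  (forall i, 0 <= w i) -> \sum_(i < d) w i = 1 ->
  (forall x : 'rV[R]_d, orthant x -> h x = \sum_(i < d) w i * x 0 i) ->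
  fine (Pr [set w | t < h (X w)]) / fine (Pr [set w | t < X w 0 (Ordinal hd)])
    @[t --> +oo] --> (1 : R).
Proof.
move=> w0 w1 hE; have [c c0 bl] := scaling_rate.
pose x_ i := fun x : 'rV[R]_d => Num.max (x 0 i) 0.
pose g x := \sum_(i <- index_enum 'I_d) w i * x_ i x.
have cx i : cone_fun (x_ i) by exact: cone_fun_coord_pos.
have cg : cone_fun g by exact: cone_fun_wsum.
have rate f : cone_fun f -> u * tail Pr X f u @[u --> +oo] --> mass mu f 1 / c.
  move=> cf; rewrite -[mass mu f 1]mul1r.
  apply: (tail_rate mX mu_fin mu_lim c0 bl cf ltr01).
  exact: (mass_null_level mX mu_fin mu_lim c0 bl cf ltr01).
(* All margins have tail equivalent to 1/t, so all coordinates have the same limit mass, and a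
   convex combination of them has it too. *)
have mx i : mass mu (x_ i) 1 = c.
  have E : mass mu (x_ i) 1 / c = 1.
    exact: (cvg_unique (@norm_hausdorff _ _) (rate _ (cx i)) (tail_coord_rate i)).
  by rewrite -[LHS](divfK (lt0r_neq0 c0)) E mul1r.
have mg : mass mu g 1 = c.
  rewrite (mass_wsum mX mu_fin mu_lim c0 bl) //.
  by under eq_bigr do rewrite mx; rewrite -mulr_suml w1 mul1r.
have Lg := rate _ cg; rewrite mg divff ?gt_eqF // in Lg.
have Lx := tail_coord_rate (Ordinal hd).
have : (u * tail Pr X g u) / (u * tail Pr X (x_ (Ordinal hd)) u) @[u --> +oo] --> (1 / 1 : R).
  by apply: cvgM => //; apply: cvgV => //; rewrite oner_neq0.
rewrite divr1; apply: cvg_trans; apply: near_eq_cvg; near=> t.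
have t0 : 0 < t by near: t; exact: nbhs_pinfty_gt.
have pos v i : x_ i (X v) = X v 0 i by rewrite /x_ (max_idPl _) //; exact: test_vector_ge0.
rewrite -mulf_div divff ?gt_eqF // mul1r; congr (fine (Pr _) / fine (Pr _)).
  congr [set _ | _]; apply/funext => v; rewrite /g hE; last exact: test_vector_ge0.
  by congr (is_true (_ < _)); apply: eq_bigr => i _; rewrite pos.
by congr [set _ | _]; apply/funext => v; rewrite pos.
Unshelve. all: by end_near. Qed.

End fixed_sample.
End linear_is_calibrated.

(** * Samples concentrated near three rays *)

Section measurable_rows.
Context {R : realType} {d : nat} {disp : measure_display} {T : measurableType disp}.

(** The sigma-algebra is generated by the open sets, each a countable union of balls with rational
    centre and radius 1/(n + 1); in the maximum norm such a ball is a finite intersection of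
    conditions on single coordinates. *)
Lemma measurable_row (f : T -> 'rV[R]_d) :
  (forall i, measurable_fun setT (fun w => f w 0 i)) ->
  measurable_fun [set: T] (f : T -> borel_rV R d).
Proof.
move=> mf; apply: (@measurability _ _ T (borel_rV R d) setT f (@open 'rV[R]_d) erefl) => // _ [U oU <-]; rewrite setTI.
pose c (p : 'rV[rat]_d * nat) : 'rV[R]_d := \row_i ratr (p.1 0 i).
pose B (p : 'rV[rat]_d * nat) : set 'rV[R]_d := ball (c p) p.2.+1%:R^-1.
pose G (p : 'rV[rat]_d * nat) : set T :=
  if `[< B p `<=` U >] then f @^-1` B p else set0.
have -> : f @^-1` U = \bigcup_p G p.
  apply/seteqP; split => [w Uw|w [p _]]; last first.
    by rewrite /G; case: asboolP => [H /H|].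
  have /nbhs_ballP [e /= e0 eU] : nbhs (f w) U by exact: open_nbhs_nbhs.
  pose n := Num.truncn (2 / e).
  have n0 : 0 < n.+1%:R^-1 :> R by rewrite invr_gt0.
  have ne : n.+1%:R^-1 < e / 2.
    by rewrite -[ltRHS]invrK ltf_pV2 ?posrE // ?invr_gt0 ?divr_gt0 // invf_div truncnS_gt.
  have rx i : {q : rat | ratr q \in `](f w 0 i - n.+1%:R^-1), (f w 0 i + n.+1%:R^-1)[ }.
    apply: cid; apply: rat_in_itvoo; rewrite ltrBlDr -addrA ltrDl addr_gt0 //.
  pose q : 'rV[rat]_d := \row_i sval (rx i).
  have cq : B (q, n) (f w).
    split => // i j; rewrite /ball /= !mxE (ord1 i).
    have := svalP (rx j); rewrite in_itv /= => /andP[h1 h2].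
    by rewrite /= ltr_distl h1 h2.
  exists (q, n) => //; rewrite /G; case: asboolP => // H; exfalso; apply: H => y By.
  apply: eU; have := ball_triangle (ball_sym cq) By.
  by apply: le_ball; rewrite /= [leRHS]splitr lerD // ltW.
apply: countable_bigcupT_measurable => [|p]; first exact: countableP.
rewrite /G; case: asboolP => // _.
have -> : f @^-1` B p = \bigcap_(i in [set: 'I_d]) [set w | `|c p 0 i - f w 0 i| < p.2.+1%:R^-1].
  apply/seteqP; split => w /=.
    by move=> [_ H] i _; exact: (H 0 i).
  by move=> H; split => // i j; rewrite (ord1 i); exact: (H j I).
apply: fin_bigcap_measurable => [|i _]; first exact: finite_finset.
have mg : measurable_fun setT (fun w => `|c p 0 i - f w 0 i|).
  by apply: measurableT_comp => //; apply: measurable_funB => //.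
have := mg measurableT `]-oo, p.2.+1%:R^-1[%classic (measurable_itv _).
by rewrite setTI; congr measurable; apply/seteqP; split => w /=; rewrite in_itv.
Qed.

End measurable_rows.

Section image_measure.
Context {d1 d2 : measure_display} {T1 : measurableType d1} {T2 : measurableType d2}
  {R : realType}.
Variables (m : {measure set T1 -> \bar R}) (f : T1 -> T2).
Hypothesis mf : measurable_fun [set: T1] f.

(* The vacuous dependence on mf lets the measure structure be inferred. *)
Definition image_measure (A : set T2) : \bar R := (fun=> m (f @^-1` A)) mf.

Let image0 : image_measure set0 = 0%E.
Proof. by rewrite /image_measure preimage_set0 measure0. Qed.

Let image_ge0 A : (0 <= image_measure A)%E.
Proof. exact: measure_ge0. Qed.

Let image_sigma_additive : semi_sigma_additive image_measure.
Proof. by rewrite /image_measure; exact: (@measure_semi_sigma_additive _ _ _ (pushforward m f)). Qed.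

HB.instance Definition _ := isMeasure.Build _ _ _ image_measure
  image0 image_ge0 image_sigma_additive.

End image_measure.

Section lebesgue_scaling.
Context {R : realType}.

Lemma measurable_divr (t : R) : measurable_fun [set: measurableTypeR R]
  (fun y : measurableTypeR R => (y / t : measurableTypeR R)).
Proof. by apply: measurable_funM. Qed.

(** The image of Lebesgue measure under y |-> y / t, divided by t, agrees with Lebesgue measure on
    half-open intervals, hence everywhere. *)
Lemma lebesgue_measure_scale (t : R) (B : set R) : 0 < t -> measurable B ->
  lebesgue_measure [set y | B (y / t)] = (t%:E * lebesgue_measure B)%E.
Proof.
move=> t0 mB.
pose f (y : R) := y / t.
have ti : 0 <= t^-1 by rewrite invr_ge0 ltW.
have E := @lebesgue_measure_unique R (mscale (NngNum ti) (image_measure lebesgue_measure (measurable_divr t))).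
rewrite (E _ B mB); last first.
  move=> _ [[a b] /= _ <-]; rewrite /mscale /image_measure /=.
  rewrite -[fun y => y / t]/f (_ : f @^-1` _ = `](t * a), (t * b)]%classic).
    rewrite !lebesgue_measure_itv /= !lte_fin ltr_pM2l //.
    case: ifP => _; last by rewrite mule0.
    by rewrite -!EFinB -EFinM -mulrBr mulKf // gt_eqF.
  by apply/seteqP; split => y; rewrite /= !in_itv /= ltr_pdivlMr // ler_pdivrMr // ![_ * t]mulrC.
by rewrite /mscale /image_measure /= muleA -EFinM divff ?gt_eqF // mul1e.
Qed.

End lebesgue_scaling.

(** * Limit measure of a curve asymptotic to a ray *)

Section ray_limit.
Context {R : realType} {d : nat}.

Lemma cvg_row (T : Type) (G : set_system T) {FG : Filter G} (f : T -> 'rV[R]_d) (l : 'rV[R]_d) :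
  (forall i, f x 0 i @[x --> G] --> l 0 i) -> f x @[x --> G] --> l.
Proof.
move=> H; apply/cvg_ballP => e e0.
have : \forall x \near G, forall i, ball (l 0 i) e (f x 0 i).
  apply: filter_forall => i; exact: (cvg_ball (H i)).
apply: filterS => x Hx; split => // i j; rewrite (ord1 i); exact: Hx.
Qed.

Lemma measurable_scale_rV (c : R) :
  measurable_fun setT ((fun x => c *: x) : borel_rV R d -> borel_rV R d).
Proof.
apply: measurable_row => i.
under eq_fun do rewrite mxE.
apply: measurable_funM => //; apply: continuous_measurable_rV; exact: coord_continuous.
Qed.

Variables (Y : measurableTypeR R -> 'rV[R]_d) (a : 'rV[R]_d) (K e : R) (A : set (borel_rV R d)).
Hypothesis mY : measurable_fun [set: measurableTypeR R] (Y : measurableTypeR R -> borel_rV R d).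
Hypothesis Y_lim : forall i, s * Y s 0 i @[s --> 0^'+] --> a 0 i.
Hypothesis Y_bound : forall s, 0 < s <= 1 -> s * `|Y s| <= K.
Hypothesis mA : measurable A.
Hypothesis e0 : 0 < e.
Hypothesis A_away : forall x : 'rV[R]_d, A x -> e <= `|x|.

(** The parameter is the inverse radius: Lebesgue measure in y = 1/r is dr/r^2 along the ray, the
    radial part of a limit measure whose tails scale like 1/s. *)
Let ray (y : R) : borel_rV R d := y^-1 *: a.

Hypothesis ray_boundary :
  lebesgue_measure [set y | 0 < y /\ (closure (A : set 'rV[R]_d) `\` interior (A : set 'rV[R]_d)) (ray y)] = 0%E.

Hypothesis mray : measurable_fun [set: measurableTypeR R] (ray : measurableTypeR R -> borel_rV R d).

Let E (w : R) : set (measurableTypeR R) := [set y | 0 < y <= w /\ A (w^-1 *: Y (y / w))].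
Let E0 : set (measurableTypeR R) := [set y | 0 < y /\ A (ray y)].
Let B (w : R) : set (measurableTypeR R) := [set s | 0 < s <= 1 /\ A (w^-1 *: Y s)].

Let mB w : measurable (B w).
Proof.
rewrite (_ : B w = `]0, 1]%classic `&` ((fun s => w^-1 *: Y s) @^-1` A)).
  apply: measurableI; first exact: measurable_itv.
  rewrite -[X in measurable X]setTI.
  exact: (measurableT_comp (measurable_scale_rV w^-1) mY).
by apply/seteqP; split => s; rewrite /B /= in_itv.
Qed.

Let EB w : 0 < w -> E w = [set y | B w (y / w)].
Proof.
move=> w0; apply/seteqP; split => y; rewrite /E /B /=.
  by move=> [/andP[y0 yw] Ay]; split => //; rewrite divr_gt0 //= ler_pdivrMr // mul1r.
by move=> [/andP[y0 yw] Ay]; split => //; move: y0 yw; rewrite pmulr_lgt0 ?invr_gt0 // ler_pdivrMr // mul1r => -> ->.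
Qed.

Let mE w : 0 < w -> measurable (E w).
Proof.
move=> w0; rewrite EB // -[X in measurable X]setTI.
exact: (measurable_divr w measurableT (mB w)).
Qed.

Let mE0 : measurable E0.
Proof.
rewrite (_ : E0 = `]0, +oo[%classic `&` (ray @^-1` A)).
  apply: measurableI; first exact: measurable_itv.
  by rewrite -[X in measurable X]setTI; exact: mray.
by apply/seteqP; split => s; rewrite /E0 /= in_itv /= andbT.
Qed.

(** For y > 0 the rescaled curve at y / w converges to [ray y]. Unless that point is on the boundary
    of [A], it is interior to [A] or to its complement, and membership is eventually decided. *)
Let E_eventually (w : nat -> R) (y : R) : (forall n, 0 < w n) -> w n @[n --> \oo] --> +oo ->
  ~ [set y | 0 < y /\ (closure (A : set 'rV[R]_d) `\` interior (A : set 'rV[R]_d)) (ray y)] y ->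
  \forall n \near \oo, \1_(E (w n)) y = \1_E0 y :> R.
Proof.
move=> w0 woo Ny.
have [y0|y0] := leP y 0.
  by near=> n; rewrite !indicE !memNset // => -[]; [|move=> /andP[]]; rewrite ltNge y0.
have cw : (w n)^-1 *: Y (y / w n) @[n --> \oo] --> ray y.
  have wi : y / w n @[n --> \oo] --> 0^'+.
    move=> S [e1 /= e10 HS].
    have : \forall n \near \oo, y / e1 < w n by exact: cvgry_gt woo _.
    apply: filterS => n wn; have p : 0 < y / w n by rewrite divr_gt0.
    apply: HS => //=; rewrite sub0r normrN gtr0_norm // ltr_pdivrMr //.
    by rewrite mulrC -ltr_pdivrMr.
  apply: cvg_row => i.
  have := @cvg_comp _ _ _ (fun n => y / w n) (fun s => s * Y s 0 i) _ _ _ wi (@Y_lim i).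
  move=> C; have C' := cvgM (cvg_cst y^-1) C.
  rewrite /ray mxE. apply: (cvg_trans _ (C' _ _)); apply: near_eq_cvg; near=> n.
  by rewrite /= mxE !mulrA mulVf ?gt_eqF // mul1r.
have [Ai|nAi] := pselect (interior (A : set 'rV[R]_d) (ray y)).
  have Ar : A (ray y) by exact: interior_subset Ai.
  have : \forall n \near \oo, A ((w n)^-1 *: Y (y / w n)) by exact: cw.
  have : \forall n \near \oo, y <= w n by exact: cvgry_ge woo _.
  apply: filterS2 => n yw An; rewrite !indicE !mem_set //.
  by split => //; rewrite y0.
have nc : ~ closure (A : set 'rV[R]_d) (ray y).
  by move=> ca; apply: Ny.
have nA : ~ A (ray y) by move=> /subset_closure.
have : \forall n \near \oo, (~` closure (A : set 'rV[R]_d)) ((w n)^-1 *: Y (y / w n)).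
  apply: cw; apply: open_nbhs_nbhs; split => //.
  by apply: closed_openC; exact: closed_closure.
have nE0 : ~ E0 y by move=> [_ /nA].
apply: filterS => n An.
have nEn : ~ E (w n) y by move=> [_ /subset_closure].
by rewrite !indicE (memNset nE0) (memNset nEn).
Unshelve. all: by end_near. Qed.

(** Supplies the integrable majorant: y e <= (y / w) |Y (y / w)| <= K, as [A] keeps distance e from
    0. *)
Let E_bound w y : 0 < w -> E w y -> y \in `[0, (K / e)].
Proof.
move=> w0 [/andP[y0 yw] Ay]; rewrite in_itv /= (ltW y0) /= ler_pdivlMr //.
have yw1 : 0 < y / w <= 1 by rewrite divr_gt0 //= ler_pdivrMr // mul1r.
apply: le_trans (Y_bound yw1).
apply: (@le_trans _ _ (y * `|w^-1 *: Y (y / w)|)); first by rewrite ler_pM2l // A_away.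
by rewrite normrZ gtr0_norm ?invr_gt0 // mulrA.
Qed.

(* Dominated convergence after the substitution s = y / t. *)
Lemma ray_limit :
  (t%:E * lebesgue_measure (Y @^-1` [set t *: x | x in A] `&` `]0%R, 1%R]%classic))%E
    @[t --> +oo] --> lebesgue_measure (ray @^-1` A `&` `]0, +oo[%classic).
Proof.
(* Dominated convergence is about sequences, so t runs along an arbitrary one; [w] modifies its
   terms below 1 to keep every index positive. *)
apply/cvge_pinftyP => u uoo.
pose w n := Num.max (u n) 1.
have w0 n : 0 < w n by rewrite lt_max ltr01 orbT.
have woo : w n @[n --> \oo] --> +oo.
  apply/cvgryPge => M; near=> n; rewrite le_max; apply/orP; left.
  by near: n; exact: cvgry_ge.
have -> : ray @^-1` A `&` `]0, +oo[%classic = E0.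
  by apply/seteqP; split => y; rewrite /E0 /= in_itv /= andbT => -[].
have : lebesgue_measure (E (w n)) @[n --> \oo] --> lebesgue_measure E0.
  have mI (S : set (measurableTypeR R)) : measurable S ->
      measurable_fun [set: measurableTypeR R] (fun y => (\1_S y : R)%:E).
    by move=> mS; apply/measurable_EFinP; exact: measurable_indic.
  have [] := @dominated_convergence _ _ _ (@lebesgue_measure R) setT measurableT
    (fun n y => (\1_(E (w n)) y)%:E) (fun y => (\1_E0 y)%:E)
    (fun y => (\1_(`[0, (K / e)]%classic) y)%:E).
  - by move=> n; apply: mI; exact: mE.
  - exact: mI.
  - exists [set y | 0 < y /\ (closure (A : set 'rV[R]_d) `\` interior (A : set 'rV[R]_d)) (ray y)].
    split => //.
      rewrite (_ : [set _ | _] = `]0, +oo[%classic `&`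
          (ray @^-1` (closure (A : set 'rV[R]_d) `\` interior (A : set 'rV[R]_d)))).
        apply: measurableI; first exact: measurable_itv.
        rewrite -[X in measurable X]setTI; apply: mray => //.
        exact: measurable_boundary.
      by apply/seteqP; split => s /=; rewrite in_itv /= andbT.
    move=> y; apply: contra_notP => Ny _.
    apply: cvg_near_cst; have := E_eventually w0 woo Ny.
    by apply: filterS => n ->.
  - exact: integrable_indic_itv.
  - apply/aeW => y n _; rewrite /= ger0_norm // lee_fin.
    rewrite !indicE; case: (pselect (E (w n) y)) => [Ey|nEy].
      have Iy : `[0, (K / e)]%classic y by exact: E_bound Ey.
    by rewrite (mem_set Ey) (mem_set Iy).
    by rewrite memNset.
  move=> _ _; rewrite integral_indic // setIT.
  apply: cvg_trans; apply: near_eq_cvg; near=> n.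
  by rewrite /= integral_indic ?setIT //; exact: mE.
apply: cvg_trans; apply: near_eq_cvg; near=> n.
have un : w n = u n.
  apply: max_idPl; near: n; exact: cvgry_ge.
rewrite EB // lebesgue_measure_scale // un; last exact: mB.
have u0 : 0 < u n by rewrite -un; exact: w0.
congr (_ * _)%E; congr (lebesgue_measure _).
apply/seteqP; split => s; rewrite /B /= in_itv /=.
  move=> [s01 As]; split => //; exists ((u n)^-1 *: Y s) => //.
  by rewrite scalerA divff ?gt_eqF // scale1r.
move=> [[x Ax <-] s01]; split => //.
by rewrite scalerA mulVf ?gt_eqF // scale1r.
Unshelve. all: by end_near. Qed.

End ray_limit.

(** * Splitting a uniform variable *)

Section uniform_pieces.
Context {R : realType}.

(* If 0 <= c <= 1 and s is uniform on (0, 1], then uniform_split c s is uniform on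
   (0, 1/3) with probability c and uniform on (1/3, 1) with probability 1 - c. *)
Definition uniform_split (c s : R) : R :=
  if s <= c then s / (3 * c) else 3^-1 + 2 / 3 * ((s - c) / (1 - c)).

(** On [0, 1] this is the distribution function of [uniform_split c s] for uniform s: density 3 c
    below 1/3 and 3 (1 - c) / 2 above. It is affine in c and equals p at c = 1/3, so averaging over
    three values of c with sum 1 gives p. *)
Definition split_level (c p : R) : R :=
  if p <= 3^-1 then 3 * c * p else c + (1 - c) * ((3 * p - 1) / 2).

Lemma split_gt (c s p : R) : 0 <= c <= 1 -> 0 < s <= 1 -> 0 <= p <= 1 ->
  (p < uniform_split c s) = (split_level c p < s).
Proof.
move=> /andP[c0 c1] /andP[s0 s1] /andP[p0 p1]; rewrite /uniform_split /split_level.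
have [sc|cs] := leP s c.
  have c0' : 0 < c by exact: lt_le_trans sc.
  have c30 : 0 < 3 * c by rewrite mulr_gt0.
  have [p3|p3] := leP p 3^-1; first by rewrite ltr_pdivlMr // mulrC.
  rewrite ltr_pdivlMr //; apply/idP/idP => H.
    exfalso; move: H; apply/negP; rewrite -leNgt; nra.
  exfalso; move: H; apply/negP; rewrite -leNgt.
  by apply: (le_trans sc); rewrite lerDl mulr_ge0 //; lra.
have c1' : 0 < 1 - c by rewrite subr_gt0 (lt_le_trans cs).
have [p3|p3] := leP p 3^-1.
  have -> : p < 3^-1 + 2 / 3 * ((s - c) / (1 - c)).
    by rewrite (le_lt_trans p3) // ltrDl mulr_gt0 ?divr_gt0 // subr_gt0.
  by apply/esym; apply: le_lt_trans cs; nra.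
set q := (s - c) / (1 - c).
have E : (1 - c) * q = s - c by rewrite mulrC mulfVK // gt_eqF.
transitivity ((3 * p - 1) / 2 < q); first by apply/idP/idP => H; lra.
by rewrite -(ltr_pM2l c1') E -ltrBrDl.
Qed.

Lemma measurable_split (c : R) : measurable_fun setT (uniform_split c).
Proof.
apply: measurable_fun_ifT => //.
- exact: measurable_fun_ler.
- exact: measurable_funM.
- apply: measurable_funD => //; apply: measurable_funM => //; apply: measurable_funM => //.
  exact: measurable_funB.
Qed.

(** Carries [quantile_bound] over to split variables, at the price of a factor 3 and uniformly in
    c. *)
Lemma split_ge (c s : R) : 0 <= c <= 1 -> 0 < s <= 1 -> s / 3 <= uniform_split c s.
Proof.
move=> /andP[c0 c1] /andP[s0 s1]; rewrite /uniform_split.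
have [sc|cs] := leP s c.
  have c0' : 0 < c by exact: lt_le_trans sc.
  by rewrite ler_pM2l // lef_pV2 ?posrE ?mulr_gt0 // ler_piMr.
have c1' : 0 < 1 - c by rewrite subr_gt0 (lt_le_trans cs).
rewrite (@le_trans _ _ 3^-1) //; first by lra.
by rewrite lerDl mulr_ge0 // divr_ge0 ?ltW // subr_gt0.
Qed.

Lemma split_le1 (c s : R) : 0 <= c <= 1 -> 0 < s <= 1 -> uniform_split c s <= 1.
Proof.
move=> c01 s01; rewrite leNgt split_gt ?ler01 ?lexx // /split_level.
have -> : (1 <= 3^-1 :> R) = false by apply/negbTE; rewrite -ltNge; lra.
rewrite -leNgt; case/andP: s01 => _ s1; rewrite mulr1.
have -> : (3 - 1) / 2 = 1 :> R by lra.
by rewrite mulr1 addrC subrK.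
Qed.

Lemma split_level_le1 (c p : R) : 0 <= c <= 1 -> 0 <= p <= 1 -> 0 <= split_level c p <= 1.
Proof.
move=> /andP[c0 c1] /andP[p0 p1]; rewrite /split_level.
case: (leP p 3^-1) => p3.
  have cp : c * p <= p by rewrite ler_piMl.
  by apply/andP; split; [rewrite !mulr_ge0|rewrite -mulrA; lra].
have m0 : 0 <= (3 * p - 1) / 2 by lra.
have m1 : (3 * p - 1) / 2 <= 1 by lra.
have c1' : 0 <= 1 - c by rewrite subr_ge0.
apply/andP; split; first by rewrite addr_ge0 // mulr_ge0.
by have := ler_piMr c1' m1; lra.
Qed.

Lemma lebesgue_split_gt (c p : R) : 0 <= c <= 1 -> 0 <= p <= 1 ->
  lebesgue_measure ([set s | p < uniform_split c s] `&` `]0, 1]%classic) = (1 - split_level c p)%:E.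
Proof.
move=> c01 p01; have /andP[l0 l1] := split_level_le1 c01 p01.
have -> : [set s | p < uniform_split c s] `&` `]0, 1]%classic = `]split_level c p, 1]%classic.
  apply/seteqP; split => s /=; rewrite !in_itv /=.
    by move=> [ps s01]; rewrite -split_gt // ps; case/andP: s01.
  move=> /andP[ls s1]; have s0 := le_lt_trans l0 ls.
  by rewrite s0 s1; split => //; rewrite split_gt // s0.
rewrite lebesgue_measure_itv /= lte_fin EFinB; case: ltP => // l1'.
have -> : split_level c p = 1 by apply/eqP; rewrite eq_le l1.
by rewrite subee.
Qed.

Variable F : cumulativeBounded (0 : R) (1 : R).
Hypothesis F_tail : (1 - F x) / x^-1 @[x --> +oo] --> (1 : R).
Hypothesis F_0minus : F x @[x --> 0^'-] --> (0 : R).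

Lemma quantile_split_bound : exists2 K : R, 0 < K & forall c s : R,
  0 <= c <= 1 -> 0 < s <= 1 -> s * quantile F (1 - uniform_split c s) <= K.
Proof.
have [C C0 HC] := quantile_bound F_tail F_0minus.
exists (3 * C); first by rewrite mulr_gt0.
move=> c s c01 s01; have sp := split_ge c01 s01; have /andP[s0 _] := s01.
have p0 : 0 < uniform_split c s by apply: lt_le_trans sp; rewrite divr_gt0.
have := HC _ p0; have := quantile_ge0 F_tail F_0minus (1 - uniform_split c s).
move: (quantile F _) => q q0 H.
apply: (@le_trans _ _ (3 * (uniform_split c s * q))); last by rewrite ler_pM2l.
by rewrite mulrA ler_wpM2r //; lra.
Qed.

(** For c > 0 and small s the split variable is u = s / (3 c), so the product is 3 c times u
    [quantile F (1 - u)]. For c = 0 it stays above 1/3, the quantile stays bounded and the product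
    vanishes. *)
Lemma quantile_split_lim (c : R) : 0 <= c <= 1 ->
  s * quantile F (1 - uniform_split c s) @[s --> 0^'+] --> 3 * c.
Proof.
move=> c01; have /andP[c0 c1] := c01; move: c0; rewrite le_eqVlt => /predU1P[c0|c0].
  rewrite -c0 mulr0; have [C C0 HC] := quantile_bound F_tail F_0minus.
  apply: (@squeeze_cvgr _ _ _ _ (fun=> 0) (fun s => s * (3 * C))).
  - near=> s.
    have s0 : 0 < s by near: s; exact: nbhs_right_gt.
    have s1 : s <= 1 by near: s; apply: nbhs_right_le.
    rewrite mulr_ge0 ?(quantile_ge0 F_tail F_0minus) ?(ltW s0) //=.
    have p3 : 3^-1 <= uniform_split 0 s.
      by rewrite /uniform_split [s <= 0]leNgt s0 /= !subr0 divr1 lerDl mulr_ge0 // ltW.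
    have p0 : 0 < uniform_split 0 s by apply: lt_le_trans p3; rewrite invr_gt0.
    rewrite ler_pM2l //; have := HC _ p0.
    have := quantile_ge0 F_tail F_0minus (1 - uniform_split 0 s).
    move: (quantile F _) => q q0 H.
    apply: (@le_trans _ _ (3 * (uniform_split 0 s * q))); last by rewrite ler_pM2l.
    by rewrite mulrA -[leLHS]mul1r ler_wpM2r //; lra.
  - exact: cvg_cst.
  - rewrite -[X in _ --> X](mul0r (3 * C)); apply: cvgMl.
    exact: (cvg_at_right_filter (@cvg_id _ _)).
have c30 : 0 < 3 * c by rewrite mulr_gt0.
have si : s / (3 * c) @[s --> 0^'+] --> 0^'+.
  move=> S [e /= e0 HS]; rewrite /nbhs /=; suff : \forall s \near 0^'+, S (s / (3 * c)) by [].
  near=> s.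
  have s0 : 0 < s by near: s; exact: nbhs_right_gt.
  apply: HS; last by rewrite divr_gt0.
  rewrite /= sub0r normrN gtr0_norm ?divr_gt0 // ltr_pdivrMr //.
  by near: s; apply: nbhs_right_lt; rewrite mulr_gt0.
have L := @cvg_comp _ _ _ (fun s => s / (3 * c)) (fun u => u * quantile F (1 - u)) _ _ _ si
  (quantile_equiv F_tail F_0minus).
have L' := cvgM (cvg_cst (3 * c)) L.
rewrite -[X in _ --> X]mulr1; apply: (cvg_trans _ (L' _ _)).
apply: near_eq_cvg; near=> s.
have sc : s <= c by near: s; apply: nbhs_right_le.
by rewrite /= /uniform_split sc mulrA mulrC [_ * (s / _)]mulrC mulfVK ?gt_eqF // mulrC.
Unshelve. all: by end_near. Qed.

End uniform_pieces.

(** * The law on three curves and its limit on three rays *)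

Section three_rays.
Context {R : realType} {d : nat}.

Definition coord_rv (i : 'I_d) (x : borel_rV R d) : R := (x : 'rV[R]_d) 0 i.

Lemma measurable_coord_rv i : measurable_fun setT (coord_rv i).
Proof. by apply: continuous_measurable_rV; exact: coord_continuous. Qed.

HB.instance Definition _ i :=
  @isMeasurableFun.Build _ _ _ _ (coord_rv i) (measurable_coord_rv i).

Definition split_row (v : 'rV[R]_d) (s : measurableTypeR R) : borel_rV R d :=
  \row_i uniform_split (v 0 i) s.

Lemma measurable_split_row v : measurable_fun [set: measurableTypeR R] (split_row v).
Proof.
apply: measurable_row => i.
rewrite (_ : (fun _ => _) = uniform_split (v 0 i)); first exact: measurable_split.
by apply/funext => s; rewrite mxE.
Qed.

Definition ray (a : 'rV[R]_d) (y : measurableTypeR R) : borel_rV R d := y^-1 *: a.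

Lemma measurable_ray a : measurable_fun [set: measurableTypeR R] (ray a).
Proof.
apply: measurable_row => i.
have minv : measurable_fun [set: measurableTypeR R] (fun y : measurableTypeR R => y^-1 : R).
  have -> : [set: measurableTypeR R] = ([set y : R | y != 0] `|` [set 0]).
    by apply/seteqP; split => // y _; have [->|y0] := eqVneq y 0; [right|left].
  have o : open [set y : R | y != 0].
    rewrite (_ : [set _ | _] = ~` [set 0]).
      by apply: closed_openC; exact: (accessible_closed_set1 (hausdorff_accessible (@norm_hausdorff _ _))).
    by apply/seteqP; split => y /= /eqP.
  apply/measurable_funU => //; first exact: open_measurable.
  split; last exact: measurable_fun_set1.
  apply: open_continuous_measurable_fun => // y; rewrite inE /= => y0.
  exact: inv_continuous.
rewrite (_ : (fun _ => _) = fun y => y^-1 * a 0 i).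
  exact: measurable_funM.
by apply/funext => y; rewrite mxE.
Qed.

Variable v : nat -> 'rV[R]_d.

Definition average (m : {measure set (borel_rV R d) -> \bar R}^nat) : set (borel_rV R d) -> \bar R :=
  mscale (3^-1)%:nng (msum m 3).

HB.instance Definition _ m := Measure.on (average m).

Definition unit_restr := mrestr (@lebesgue_measure R) (measurable_itv `]0, 1]).
HB.instance Definition _ := Measure.on unit_restr.

Definition pos_restr := mrestr (@lebesgue_measure R) (measurable_itv `]0, +oo[).
HB.instance Definition _ := Measure.on pos_restr.

(** The joint law of (P_i) is built directly on R^d, and the P_i will be the coordinates, so no
    space carrying both j and s is needed. *)
Definition three_ray_law : set (borel_rV R d) -> \bar R :=
  average (fun j => image_measure unit_restr (measurable_split_row (v j))).
HB.instance Definition _ := Measure.on three_ray_law.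

(** The factor 3 comes from X being close to (3 / s) v_j; it cancels the weight 1/3 when the mass of
    {g > 1} is computed. *)
Definition three_ray_limit : set (borel_rV R d) -> \bar R :=
  average (fun j => image_measure pos_restr (measurable_ray (3 *: v j))).
HB.instance Definition _ := Measure.on three_ray_limit.

Lemma three_ray_lawE A : three_ray_law A = ((3^-1)%:E * \sum_(j < 3)
  lebesgue_measure (split_row (v j) @^-1` A `&` `]0%R, 1%R]%classic))%E.
Proof. by []. Qed.

Lemma three_ray_limitE A : three_ray_limit A = ((3^-1)%:E * \sum_(j < 3)
  lebesgue_measure (ray (3 *: v j) @^-1` A `&` `]0%R, +oo[%classic))%E.
Proof. by []. Qed.

Let three_ray_law_setT : three_ray_law setT = 1%E.
Proof.
rewrite three_ray_lawE; under eq_bigr do rewrite preimage_setT setTI lebesgue_measure_itv /= lte_fin ltr01 sube0.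
by rewrite sumEFin big_const_ord /= -EFinM; congr EFin; lra.
Qed.

HB.instance Definition _ := Measure_isProbability.Build _ _ R three_ray_law three_ray_law_setT.

End three_rays.

(** * Regular variation and calibration of the three-ray sample *)

Section three_ray_sample.
Context {R : realType} {d : nat} (hd : (0 < d)%N).
Variable F : cumulativeBounded (0 : R) (1 : R).
Hypothesis F_tail : (1 - F x) / x^-1 @[x --> +oo] --> (1 : R).
Hypothesis F_0minus : F x @[x --> 0^'-] --> (0 : R).
Variable v : nat -> 'rV[R]_d.
Hypothesis v_01 : forall j i, 0 <= v j 0 i <= 1.
Hypothesis v_sum : forall i, \sum_(j < 3) v j 0 i = 1.
Hypothesis v_neq0 : forall j, v j != 0.

Let Pr : probability (borel_rV R d) R := three_ray_law v.
Let P (i : 'I_d) : {RV Pr >-> R} := coord_rv i.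
Let X := test_vector F (fun i => P i : borel_rV R d -> R).

Let PrE (S : set (borel_rV R d)) : Pr S = ((3^-1)%:E * \sum_(j < 3)
  lebesgue_measure (split_row (v j) @^-1` S `&` `]0%R, 1%R]%classic))%E.
Proof. exact: three_ray_lawE. Qed.

Let split_gt_tail (p : R) i :
  distribution Pr (P i) `]p, +oo[%classic = uniform_prob (@ltr01 R) `]p, +oo[%classic.
Proof.
rewrite uniform01E // /distribution /pushforward PrE.
have E (j : 'I_3) : split_row (v j) @^-1` (P i @^-1` `]p, +oo[%classic) =
    [set s | p < uniform_split (v j 0 i) s].
  by apply/seteqP; split => s /=; rewrite in_itv /= andbT /coord_rv mxE.
under eq_bigr do rewrite E.
have [p0|p0] := ltP p 0.
  have E1 (j : 'I_3) : [set s | p < uniform_split (v j 0 i) s] `&` `]0, 1]%classic = `]0, 1]%classic.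
    apply/seteqP; split => [s []//|s /= s01]; split => //.
    move: s01; rewrite in_itv /= => s01; apply: (lt_le_trans p0).
    by apply: le_trans (split_ge (v_01 _ _) s01); rewrite divr_ge0 // ltW //; case/andP: s01.
  under eq_bigr do rewrite E1 lebesgue_measure_itv /= lte_fin ltr01 sube0.
  have -> : `]p, +oo[%classic `&` `[0, 1]%classic = `[0, 1]%classic.
    apply/seteqP; split => [s []//|s /= s01]; split => //.
    by move: s01; rewrite !in_itv /= andbT => /andP[s0 _]; exact: lt_le_trans s0.
  rewrite lebesgue_measure_itv /= lte_fin ltr01 sube0.
  by rewrite sumEFin big_const_ord /= -EFinM; congr EFin; lra.
have [p1|p1] := leP p 1.
  have p01 : 0 <= p <= 1 by rewrite p0.
  under eq_bigr do rewrite lebesgue_split_gt //.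
  have -> : `]p, +oo[%classic `&` `[0, 1]%classic = `]p, 1]%classic.
    apply/seteqP; split => s /=; rewrite !in_itv /= andbT.
      by move=> [-> /andP[]].
    by move=> /andP[ps ->]; rewrite ps (le_trans p0 (ltW ps)).
  rewrite lebesgue_measure_itv /= lte_fin.
  have -> : (if p < 1 then (1%:E - p%:E)%E else 0%E) = (1 - p)%:E.
    case: ltP => // p1'; have -> : p = 1 by apply/eqP; rewrite eq_le p1.
    by rewrite subrr.
  rewrite sumEFin -EFinM; congr EFin.
  (* On either side of p = 1/3 the three levels are affine in the [v j 0 i], which sum to 1, and
     their average is p. *)
  have := v_sum i; rewrite !big_ord_recr !big_ord0 /= /split_level.
  by case: (leP p 3^-1) => _; move: (v _ _ _) (v _ _ _) (v _ _ _) => a b c; nra.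
have E1 (j : 'I_3) : [set s | p < uniform_split (v j 0 i) s] `&` `]0, 1]%classic = set0.
  rewrite -subset0 => s [/= ps]; rewrite in_itv /= => s01.
  by have := split_le1 (v_01 j i) s01; rewrite leNgt (lt_trans p1 ps).
under eq_bigr do rewrite E1 measure0.
rewrite big1 // mule0; apply/esym.
rewrite (_ : _ `&` _ = set0) ?measure0 // -subset0 => s /=.
rewrite !in_itv /= andbT => -[ps /andP[_ s1]].
by have := lt_trans p1 ps; rewrite ltNge s1.
Qed.

Let uniform_P i : uniform01 (P i).
Proof.
move=> A mA.
have mc : measurable_fun [set: borel_rV R d] (coord_rv i : borel_rV R d -> measurableTypeR R).
  exact: measurable_coord_rv.
have H := (@measure_unique _ R (measurableTypeR R) (@RGenOInfty.G R) (fun n => `](- n%:R), +oo[%classic)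
  (RGenOInfty.measurableE R) _ _ _ (image_measure Pr mc) (uniform_prob (@ltr01 R))).
  apply: H.
- move=> _ _ [a ->] [b ->]; exists (Num.max a b); apply/seteqP.
  split => x /=; rewrite !in_itv /= !andbT gt_max; first by move=> [-> ->].
  by move=> /andP[].
- by move=> n; exists (- n%:R).
- apply/seteqP; split => // x _; exists (Num.truncn `|x|).+1 => //=.
  rewrite in_itv /= andbT ltrNl (le_lt_trans _ (truncnS_gt _)) //.
  by rewrite -normrN ler_norm.
- by move=> _ [p ->]; exact: split_gt_tail.
- move=> k /=; apply: (@le_lt_trans _ _ 1%E); last exact: ltry.
  apply: probability_le1; rewrite -[X in measurable X]setTI.
  by apply: mc => //; exact: measurable_itv.
- exact: mA.
Qed.

Let mX : measurable_fun [set: borel_rV R d] (X : borel_rV R d -> borel_rV R d).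
Proof.
apply: measurable_row => i.
rewrite (_ : (fun _ => _) = quantile F \o (fun w => 1 - coord_rv i w)).
  apply: measurableT_comp; first exact: measurable_quantile F_tail F_0minus.
  by apply: measurable_funB => //; exact: measurable_coord_rv.
by apply/funext => w; rewrite mxE.
Qed.

Let Y j (s : measurableTypeR R) : 'rV[R]_d := X (split_row (v j) s).

Let YE j s i : Y j s 0 i = quantile F (1 - uniform_split (v j 0 i) s).
Proof. by rewrite /Y /X /test_vector mxE /P /= /coord_rv mxE. Qed.

Let mu : {measure set (borel_rV R d) -> \bar R} := three_ray_limit v.

Let muE (S : set (borel_rV R d)) : mu S = ((3^-1)%:E * \sum_(j < 3)
  lebesgue_measure (ray (3 *: v j) @^-1` S `&` `]0%R, +oo[%classic))%E.
Proof. exact: three_ray_limitE. Qed.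

Let ray_away j (A : set (borel_rV R d)) (e : R) : 0 < e -> (forall x : 'rV[R]_d, A x -> e <= `|x|) ->
  ray (3 *: v j) @^-1` A `&` `]0%R, +oo[%classic `<=` `]0, (`|3 *: v j| / e)]%classic.
Proof.
move=> e0 Ae y [/= Ay]; rewrite !in_itv /= andbT => y0; rewrite y0 /= ler_pdivlMr //.
have := Ae _ Ay; rewrite normrZ gtr0_norm ?invr_gt0 // => ey.
by rewrite mulrC -ler_pdivlMr // mulrC.
Qed.

Let m_ray_set j (A : set (borel_rV R d)) : measurable A ->
  measurable (ray (3 *: v j) @^-1` A `&` `]0%R, +oo[%classic).
Proof.
move=> mA; apply: measurableI => //.
by rewrite -[X in measurable X]setTI; exact: measurable_ray.
Qed.

Let mu_fin (A : set (borel_rV R d)) : measurable A -> bounded_away0 A -> (mu A < +oo)%E.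
Proof.
move=> mA [e e0 Ae]; rewrite muE lte_mul_pinfty //.
apply/lte_sum_pinfty => j _; apply: (@le_lt_trans _ _ (lebesgue_measure `]0, (`|3 *: v j| / e)]%classic)).
  by apply: le_measure; rewrite ?inE //; [exact: m_ray_set|exact: ray_away].
by rewrite lebesgue_measure_itv /=; case: ifP => // _; rewrite sube0 ltry.
Qed.

Let Y_limit j (A : set (borel_rV R d)) : measurable A -> bounded_away0 A ->
  mu (closure (A : set 'rV[R]_d) `\` interior (A : set 'rV[R]_d)) = 0%E -> (j < 3)%N ->
  (t%:E * lebesgue_measure (Y j @^-1` [set t *: x | x in A] `&` `]0%R, 1%R]%classic))%E
    @[t --> +oo] --> lebesgue_measure (ray (3 *: v j) @^-1` A `&` `]0%R, +oo[%classic).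
Proof.
move=> mA [e e0 Ae] null j3.
have [K K0 HK] := quantile_split_bound F_tail F_0minus.
apply: (@ray_limit _ _ (Y j) (3 *: v j) K e) => //.
- by apply: (measurableT_comp mX); exact: measurable_split_row.
- move=> i; rewrite mxE; apply: cvg_trans (quantile_split_lim F_tail F_0minus (v_01 j i)).
  by apply: near_eq_cvg; near=> s; rewrite YE.
- move=> s s01; have [s0 _] := andP s01.
  have [->|nz] := eqVneq `|Y j s| 0; first by rewrite mulr0 ltW.
  have [[a i] /= E] := mx_norm_neq0 nz.
  rewrite [X in _ * X]E (ord1 a) YE ger0_norm; first exact: HK.
  exact: (quantile_ge0 F_tail F_0minus).
- apply/eqP; rewrite eq_le measure_ge0 andbT.
  (* A null boundary for the average is null for each of the three rays, the terms being
     nonnegative. *)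
  move/eqP: null; rewrite muE mule_eq0 /= => /orP[|/eqP].
    by rewrite eqe invr_eq0 pnatr_eq0.
  move=> /eqP; rewrite seq_psume_eq0 // => /allP/(_ (Ordinal j3) (mem_index_enum _)) /= /eqP <-.
  rewrite [X in (_ <= lebesgue_measure X)%E](_ : _ =
    [set y | 0 < y /\ (closure (A : set 'rV[R]_d) `\` interior (A : set 'rV[R]_d)) (y^-1 *: (3 *: v j))]) //.
  by apply/seteqP; split => y; rewrite /= in_itv /= andbT => -[].
- exact: measurable_ray.
Unshelve. all: by end_near. Qed.

Let mu_lim (A : set (borel_rV R d)) : measurable A -> bounded_away0 A ->
  mu (closure (A : set 'rV[R]_d) `\` interior (A : set 'rV[R]_d)) = 0%E ->
  (t%:E * Pr (X @^-1` [set t *: x | x in (A : set 'rV[R]_d)]))%E @[t --> +oo] --> mu A.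
Proof.
move=> mA bA null; rewrite muE.
have : ((3^-1)%:E * \sum_(j < 3) (t%:E * lebesgue_measure
   (Y j @^-1` [set t *: x | x in A] `&` `]0%R, 1%R]%classic)))%E @[t --> +oo] -->
   ((3^-1)%:E * \sum_(j < 3) lebesgue_measure (ray (3 *: v j) @^-1` A `&` `]0%R, +oo[%classic))%E.
  apply: cvgeZl => //; apply: cvg_nnesum => [j _|j _]; last exact: Y_limit.
  near=> t; apply: mule_ge0 => //; rewrite lee_fin; near: t.
  by apply: nbhs_pinfty_ge; exact: num_real.
apply: cvg_trans; apply: near_eq_cvg; near=> t.
have t0 : 0 <= t by near: t; apply: nbhs_pinfty_ge; exact: num_real.
rewrite PrE muleCA; congr (_ * _)%E.
by rewrite ge0_sume_distrr.
Unshelve. all: by end_near. Qed.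

(** A zero [v j] would collapse its ray to the origin and put infinite mass there; hence the
    requirement that the three vectors be nonzero. *)
Let mu0 : mu [set 0] = 0%E.
Proof.
rewrite muE big1 ?mule0 // => j _.
rewrite (_ : _ `&` _ = set0) ?measure0 // -subset0 => y [/= /eqP].
rewrite /ray scaler_eq0 invr_eq0 in_itv /= andbT => /orP[/eqP->|]; first by rewrite ltxx.
by rewrite scaler_eq0 (negbTE (v_neq0 _)) orbF pnatr_eq0.
Qed.

Let muT : mu [set: 'rV[R]_d] <> 0%E.
Proof.
rewrite muE => /eqP; rewrite mule_eq0 => /orP[|].
  by rewrite eqe invr_eq0 pnatr_eq0.
rewrite seq_psume_eq0 // => /allP/(_ ord0 (mem_index_enum _)) /=.
by rewrite preimage_setT setTI lebesgue_measure_itv /= ltry.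
Qed.

Let rv : regularly_varying Pr X.
Proof.
split; first exact: mX.
by exists id, mu; split.
Qed.

Let v_orthant j : orthant (v j).
Proof. by move=> i; case/andP: (v_01 j i). Qed.

(** The j-th ray is in {g > 1} exactly for 0 < y < 3 g(v_j). *)
Let mass_mu g : cone_fun g -> (forall x : 'rV[R]_d, orthant x -> 0 <= g x) ->
  mass mu g 1 = \sum_(j < 3) g (v j).
Proof.
move=> cg g0; rewrite /mass muE.
have E (j : 'I_3) : lebesgue_measure (ray (3 *: v j) @^-1` [set x | 1 < g x] `&`
    `]0, +oo[%classic) = (3 * g (v j))%:E.
  have gv : 0 <= 3 * g (v j) by rewrite mulr_ge0 // g0.
  rewrite (_ : _ `&` _ = `]0, (3 * g (v j))[%classic).
    rewrite lebesgue_measure_itv /= lte_fin sube0.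
    by case: ltP => // gv'; congr EFin; apply/eqP; rewrite eq_le gv.
  have [_ hg] := cg.
  apply/seteqP; split => y /=; rewrite !in_itv /= andbT.
    move=> [+ y0]; rewrite /ray hg ?invr_gt0 // hg // y0 /=.
    by rewrite mulrC ltr_pdivlMr // mul1r.
  move=> /andP[y0 yg]; split => //.
  by rewrite /ray hg ?invr_gt0 // hg // mulrC ltr_pdivlMr // mul1r.
under eq_bigr do rewrite E.
by rewrite sumEFin -EFinM /= -mulr_sumr mulrA mulVf ?mul1r // pnatr_eq0.
Qed.

(** Here [g] extends [h] from the orthant to a function to which the tail limits apply. The
    calibration ratio tends to the sum of the g(v_j) for this sample, and to 1 by assumption. *)
Lemma three_ray_calibration h g : universally_calibrated hd F h ->
  cone_fun g -> (forall x : 'rV[R]_d, orthant x -> 0 <= g x) ->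
  (forall x : 'rV[R]_d, orthant x -> g x = h x) ->
  \sum_(j < 3) h (v j) = 1.
Proof.
move=> cal cg g0 gh; have C := cal _ _ Pr P uniform_P rv.
have bl : id t / t @[t --> +oo] --> (1 : R).
  apply: cvg_near_cst; near=> t.
  by rewrite divff // gt_eqF //; near: t; exact: nbhs_pinfty_gt.
have Lg : u * tail Pr X g u @[u --> +oo] --> \sum_(j < 3) g (v j).
  rewrite -mass_mu // -[mass mu g 1]mul1r -[1 * _]divr1.
  apply: (tail_rate mX mu_fin mu_lim ltr01 bl cg ltr01).
  exact: (mass_null_level mX mu_fin mu_lim ltr01 bl cg ltr01).
have Lx := tail_coord_rate F_tail F_0minus uniform_P (Ordinal hd).
have Lr : (u * tail Pr X g u) / (u * tail Pr X (fun x => Num.max (x 0 (Ordinal hd)) 0) u)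
    @[u --> +oo] --> (\sum_(j < 3) g (v j)) / 1.
  by apply: cvgM => //; apply: cvgV => //; rewrite oner_neq0.
have XO w : orthant (X w) by exact: (test_vector_ge0 F_tail F_0minus).
have : fine (Pr [set w | t < h (X w)]) / fine (Pr [set w | t < X w 0 (Ordinal hd)])
    @[t --> +oo] --> (\sum_(j < 3) g (v j)) / 1.
  apply: cvg_trans Lr; apply: near_eq_cvg; near=> t.
  have t0 : 0 < t by near: t; exact: nbhs_pinfty_gt.
  rewrite -mulf_div divff ?gt_eqF // mul1r; congr (fine (Pr _) / fine (Pr _)).
    by congr [set _ | _]; apply/funext => w; rewrite gh.
  by congr [set _ | _]; apply/funext => w; rewrite (max_idPl _) //; exact: XO.
move=> C'; have := cvg_unique (@norm_hausdorff _ _) C' C.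
rewrite divr1 => <-; apply: eq_bigr => j _; rewrite gh //.
Unshelve. all: by end_near. Qed.

End three_ray_sample.

(** * Additivity of calibrated functions *)

Section additive_on_orthant.
Context {R : realType} {d : nat} (hd : (0 < d)%N).

Definition pos_part (x : 'rV[R]_d) : 'rV[R]_d := \row_i Num.max (x 0 i) 0.

Lemma orthant_pos_part x : orthant (pos_part x).
Proof. by move=> i; rewrite mxE le_max lexx orbT. Qed.

Lemma pos_part_id x : orthant x -> pos_part x = x.
Proof. by move=> ox; apply/rowP => i; rewrite mxE (max_idPl _). Qed.

Variable h : 'rV[R]_d -> R.
Hypothesis h_hom : pos_homogeneous h.

(** [pos_part] is a continuous homogeneous retraction onto the orthant, so composing with it extends
    [h] without losing continuity or homogeneity. *)
Lemma cone_fun_pos_part : {within @orthant R d, continuous h} ->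
  cone_fun (fun x => h (pos_part x)).
Proof.
move=> /subspace_continuousP hc; split; last first.
  move=> a x a0; rewrite -h_hom //; last exact: orthant_pos_part.
  by congr h; apply/rowP => i; rewrite !mxE maxr_pMr ?mulr0 // ltW.
move=> x; have cp : pos_part y @[y --> x] --> pos_part x.
  apply: (@cvg_row _ _ _ (nbhs x) (nbhs_filter x)) => i; rewrite mxE.
  under eq_fun do rewrite mxE.
  by have [+ _] := cone_fun_coord_pos (R := R) i; apply.
move=> S HS; have := cp _ (hc _ (orthant_pos_part x) S HS).
apply: (@filterS _ (nbhs x) (nbhs_filter x)) => y /=; apply; exact: orthant_pos_part.
Qed.

Hypothesis h_three : forall u1 u2 u3 : 'rV[R]_d,
  orthant u1 -> orthant u2 -> orthant u3 -> u1 != 0 -> u2 != 0 -> u3 != 0 ->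
  (forall i, u1 0 i + u2 0 i + u3 0 i = 1) -> h u1 + h u2 + h u3 = 1.

Let orthantD (x y : 'rV[R]_d) : orthant x -> orthant y -> orthant (x + y).
Proof. by move=> ox oy i; rewrite mxE addr_ge0. Qed.

Let orthantZ (a : R) (x : 'rV[R]_d) : 0 <= a -> orthant x -> orthant (a *: x).
Proof. by move=> a0 ox i; rewrite mxE mulr_ge0. Qed.

Let h0 : h 0 = 0.
Proof.
have o0 : orthant (0 : 'rV[R]_d) by move=> i; rewrite mxE.
have := h_hom (ltr0Sn R 1) o0; rewrite scaler0 mulr_natl mulr2n.
by move/eqP; rewrite eq_sym -subr_eq0 addrK => /eqP.
Qed.

Let orthantD_neq0 (x y : 'rV[R]_d) : orthant x -> orthant y -> x != 0 -> x + y != 0.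
Proof.
move=> ox oy; apply: contraNneq => xy; apply/eqP/rowP => i; rewrite mxE.
have := congr1 (fun z : 'rV[R]_d => z 0 i) xy; rewrite !mxE.
by move/eqP; rewrite paddr_eq0 // => /andP[/eqP].
Qed.

(* The triples (v, w, 1 - v - w) and ((v + w)/2, (v + w)/2, 1 - v - w) have the
   same sum, so h v + h w = h (v + w). *)
Lemma three_additive (x y : 'rV[R]_d) : orthant x -> orthant y -> h (x + y) = h x + h y.
Proof.
move=> ox oy.
have [->|x0] := eqVneq x 0; first by rewrite add0r h0 add0r.
have [->|y0] := eqVneq y 0; first by rewrite addr0 h0 addr0.
have N0 : 0 < 2 * (`|x| + `|y|) by rewrite mulr_gt0 // addr_gt0 // normr_gt0.
(* Scales x + y so that its coordinates are at most 1/2; the third vector [u] then has coordinates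
   at least 1/2, so it is in the orthant and nonzero. *)
pose k := (2 * (`|x| + `|y|))^-1; have k0 : 0 < k by rewrite invr_gt0.
pose v := k *: x; pose w := k *: y; pose u : 'rV[R]_d := const_mx 1 - (v + w).
have ov : orthant v by apply: orthantZ => //; exact: ltW.
have ow : orthant w by apply: orthantZ => //; exact: ltW.
have vn : v != 0 by rewrite scaler_eq0 (negbTE x0) orbF gt_eqF.
have wn : w != 0 by rewrite scaler_eq0 (negbTE y0) orbF gt_eqF.
have coord_norm (z : 'rV[R]_d) i : z 0 i <= `|z|.
  apply: le_trans (ler_norm _) _.
  rewrite -[leRHS]/(mx_norm z) mx_normrE.
  by rewrite (le_bigmax_cond _ (fun ij => `|z ij.1 ij.2|) (j := (0, i))).
have u2 i : 2^-1 <= u 0 i.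
  rewrite !mxE lerBrDr -lerBrDl -mulrDr.
  have -> : 1 - 2^-1 = 2^-1 :> R by lra.
  have -> : 2^-1 = k * (`|x| + `|y|).
    rewrite /k invfM -mulrA mulVf ?mulr1 // gt_eqF //.
    by rewrite addr_gt0 // normr_gt0.
  by rewrite ler_pM2l // lerD.
have ou : orthant u by move=> i; apply: le_trans (u2 i); rewrite invr_ge0.
have un : u != 0.
  apply: contraTneq (u2 (Ordinal hd)) => ->.
  by rewrite mxE -ltNge invr_gt0.
pose m := 2^-1 *: (v + w).
have om : orthant m by apply: orthantZ; [rewrite invr_ge0|exact: orthantD].
have mn : m != 0 by rewrite scaler_eq0 (negbTE (orthantD_neq0 ov ow vn)) orbF invr_eq0 pnatr_eq0.
have E1 : h v + h w + h u = 1 by apply: h_three => // i; rewrite !mxE; lra.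
have E2 : h m + h m + h u = 1 by apply: h_three => // i; rewrite !mxE; lra.
have ovw := orthantD ov ow.
have E3 : h m = 2^-1 * h (v + w) by rewrite /m h_hom // invr_gt0.
have E4 : h (v + w) = h v + h w by lra.
have kn : k != 0 by rewrite gt_eqF.
have oxy := orthantD ox oy.
by move: E4; rewrite /v /w -scalerDr !h_hom // -mulrDr => /(mulfI kn).
Qed.

Lemma three_linear : let w i := h (delta_mx 0 i) in
  \sum_(i < d) w i = 1 /\
  forall x : 'rV[R]_d, orthant x -> h x = \sum_(i < d) w i * x 0 i.
Proof.
move=> w.
have od i : orthant (delta_mx 0 i : 'rV[R]_d) by move=> j; rewrite mxE /= ler0n.
have lin (x : 'rV[R]_d) : orthant x -> h x = \sum_(i < d) w i * x 0 i.
  move=> ox; rewrite [in LHS](row_sum_delta x).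
  have [_ ->] : orthant (\sum_(i < d) x 0 i *: delta_mx 0 i : 'rV[R]_d) /\
    h (\sum_(i < d) x 0 i *: delta_mx 0 i) = \sum_(i < d) x 0 i * w i.
    elim/big_ind2 : _ => //; first by split => // i; rewrite mxE.
      by move=> a b c e [oa ea] [oc ec]; split; [exact: orthantD|rewrite three_additive // ea ec].
    move=> i _; split; first exact: orthantZ.
    (* Homogeneity is only given for positive factors; a zero coordinate needs h 0 = 0. *)
    have [x0|x0] := leP (x 0 i) 0; last by rewrite h_hom.
    have -> : x 0 i = 0 by apply/eqP; rewrite eq_le x0 ox.
    by rewrite scale0r h0 mul0r.
  by apply: eq_bigr => i _; rewrite mulrC.
(* The triple of three equal vectors (1/3, ..., 1/3) normalizes the weights. *)
split => //; pose t : 'rV[R]_d := const_mx 3^-1.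
have ot : orthant t by move=> i; rewrite mxE invr_ge0.
have tn : t != 0.
  apply/eqP => /rowP/(_ (Ordinal hd)); rewrite !mxE => /eqP.
  by rewrite invr_eq0 pnatr_eq0.
have ts i : t 0 i + t 0 i + t 0 i = 1 by rewrite !mxE; lra.
have := h_three ot ot ot tn tn tn ts; rewrite lin //.
under eq_bigr do rewrite mxE.
by rewrite -mulr_suml; lra.
Qed.

End additive_on_orthant.

Theorem theorem5 (R : realType) (d : nat) (hd : (0 < d)%N)
    (F : cumulativeBounded (0 : R) (1 : R))
    (F_tail : (1 - F x) / x^-1 @[x --> +oo] --> (1 : R))
    (F_0minus : F x @[x --> 0^'-] --> (0 : R))
    (h : 'rV[R]_d -> R)
    (h_ge0 : forall x, orthant x -> 0 <= h x)
    (h_cont : {within @orthant R d, continuous h})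
    (h_hom : pos_homogeneous h) :
  universally_calibrated hd F h <->
  exists w : 'I_d -> R,
    [/\ forall i, 0 <= w i,
        \sum_(i < d) w i = 1
      & forall x : 'rV[R]_d, orthant x -> h x = \sum_(i < d) w i * x 0 i].
Proof.
split=> [cal|[w [w0 w1 hE]] disp T Pr P uP X [mX [b [mu [b0 _ [mu0 muT] mu_fin mu_lim]]]]]; last first.
  exact: (linear_tail_ratio hd F_tail F_0minus uP mX b0 mu0 muT mu_fin mu_lim w0 w1 hE).
have [|w1 lin] := three_linear hd h_hom; last first.
  exists (fun i => h (delta_mx 0 i)); split => // i; apply: h_ge0 => j.
  by rewrite mxE /= ler0n.
move=> u1 u2 u3 o1 o2 o3 n1 n2 n3 s1.
(* The sample is indexed by all naturals although only j < 3 enters the sums; repeating [u3] keeps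
   the bounds and nonvanishing true for every j. *)
pose v (j : nat) : 'rV[R]_d := if j is j'.+1 then if j' is _.+1 then u3 else u2 else u1.
have ov j : orthant (v j) by case: j => [|[|j]].
have nv j : v j != 0 by case: j => [|[|j]].
have v01 j i : 0 <= v j 0 i <= 1.
  rewrite ov /=; have := s1 i; have := o1 i; have := o2 i; have := o3 i.
  by case: j => [|[|j]] /=; lra.
have vs i : \sum_(j < 3) v j 0 i = 1.
  by rewrite !big_ord_recr big_ord0 /= add0r.
have := three_ray_calibration F_tail F_0minus v01 vs nv cal (cone_fun_pos_part h_hom h_cont).
rewrite !big_ord_recr big_ord0 /= add0r; apply.
  by move=> x _; apply: h_ge0; exact: orthant_pos_part.
by move=> x ox; rewrite pos_part_id.
Qed.
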